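(* Let $f(x)=\frac12 x^TQx+p^Tx+r$ be a quadratic function on $\mathbb{R}^d$ with $Q$ symmetric positive definite, with smallest eigenvalue $\mu$ and largest eigenvalue $L$, $0<\mu<L$. Consider GMM iterations with parameters $\alpha>0,\beta,\nu\ge0$ such that $\rho(A_Q)<1$ and with initialization $x_0=x_{-1}=x_*$. Let $\lambda_*\in\{\mu,L\}$ be a maximizer of $\max_{\lambda\in\{\mu,L\}}\frac{\sqrt\lambda}{r_\lambda}$. Let $u_1\in\mathbb{R}^d$ be a unit-norm eigenvector of $Q$ for the eigenvalue $\mu$, let $u_d\in\mathbb{R}^d$ be a unit-norm eigenvector of $Q$ for the eigenvalue $L$, and set $u_*=u_1$ if $\lambda_*=\mu$ and $u_*=u_d$ if $\lambda_*=L$. Let $$\omega_*=\begin{cases}\arccos\!\Big(-\frac{b_{\lambda_*}(1+c_{\lambda_*})}{4c_{\lambda_*}}\Big) & \text{if } c_{\lambda_*}>0\text{ and }|b_{\lambda_*}(1+c_{\lambda_*})|<4|c_{\lambda_*}|,\\ \pi & \text{if } c_{\lambda_*}\le0\text{ and }(1-b_{\lambda_*}+c_{\lambda_*})^2\le(1+b_{\lambda_*}+c_{\lambda_*})^2,\\ \pi & \text{if } |b_{\lambda_*}(1+c_{\lambda_*})|\ge4|c_{\lambda_*}|\text{ and }(1-b_{\lambda_*}+c_{\lambda_*})^2\le(1+b_{\lambda_*}+c_{\lambda_*})^2,\\ 0 & \text{otherwise.}\end{cases}$$ For given $h\in(0,1)$ and $k\ge0$, consider the noise sequence $$w_k^{(h)}=\sqrt{h(2-h)}\,(1-h)^k\cos(\omega_*k)\,u_*\in\mathbb{R}^d.$$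 Let $\{x_k^{(h)}\}_{k\ge0}$ be the GMM iterates with gradient errors $\{w_k^{(h)}\}_{k\ge0}$, and $\{z_k^{(h)}\}_{k\ge0}$ the corresponding output. Then $\sum_{k\ge0}\|w_k^{(h)}\|^2<\infty$ for every $h\in(0,1)$, and $\{w_k^{(h)}\}_{k\ge0}$ is an almost worst-case sequence in the sense that $$\frac{\sqrt{\sum_{k\ge0}\big(f(x_k^{(h)})-f(x_* )\big)}}{\|w^{(h)}\|_{\ell_2}}=\frac{\|z^{(h)}\|_{\ell_2}}{\|w^{(h)}\|_{\ell_2}}\to L_{2,*}=H_\infty\quad\text{as }h\to0,$$ where $L_{2,*}=\frac{\alpha}{\sqrt2}\max_{\lambda\in\{\mu,L\}}\frac{\sqrt\lambda}{r_\lambda}$.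
   Context: Generalized momentum method (GMM) with gradient errors $w_k\in\mathbb{R}^d$ and parameters $(\alpha,\beta,\nu)$: starting from $x_0=x_{-1}\in\mathbb{R}^d$, $$x_{k+1}=x_k-\alpha(\nabla f(y_k)+w_k)+\beta(x_k-x_{k-1}),\qquad y_k=x_k+\nu(x_k-x_{k-1}),\quad k\ge 0.$$ Let $x_*$ be the minimizer of $f$, and let $\|v\|_{\ell_2}=(\sum_{k\ge0}\|v_k\|^2)^{1/2}$ for a sequence $v=\{v_k\}$. $\ell_2$ gain (worst-case robustness): $L_{2,*}$ is the infimum of all $\gamma>0$ for which there is a function $\overline H:\mathbb{R}^d\to[0,\infty)$, independent of the error sequence, with $\overline H(x_* )=0$, such that for every initialization $x_0=x_{-1}\in\mathbb{R}^d$ and every square-summable $\{w_k\}_{k\ge0}\subset\mathbb{R}^d$, $$\sum_{k\ge0}(f(x_k)-f(x_* ))\le\gamma^2\sum_{k\ge0}\|w_k\|^2+\overline H(x_0).$$ Matrices: with $Q=U\Lambda U^T$ an orthogonal eigendecomposition (eigenvalues in increasing order), $$A_Q=\begin{bmatrix}(1+\beta)I_d-\alpha(1+\nu)Q & -\beta I_d+\alpha\nu Q\\ I_d & 0_d\end{bmatrix},\quad B=\begin{bmatrix}-\alpha I_d\\ 0_d\end{bmatrix},\quad T=\begin{bmatrix}\tfrac{1}{\sqrt2}\Lambda^{1/2}U^T & 0_d\end{bmatrix}.$$ The output is $z_k=T\begin{bmatrix}x_k-x_*\\ x_{k-1}-x_*\end{bmatrix}$, so that $\|z_k\|^2=f(x_k)-f(x_*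 )$. $\rho(\cdot)$ is the spectral radius and $\|\cdot\|$ the spectral norm for matrices. The $H_\infty$ norm (for $\rho(A_Q)<1$) is $H_\infty:=\max_{z\in\mathbb{C},|z|=1}\|G(z)\|$ with $G(z):=T(zI-A_Q)^{-1}B$. For $\lambda>0$: $b_\lambda:=\alpha\lambda(1+\nu)-(1+\beta)$, $c_\lambda:=\beta-\alpha\lambda\nu$, and $r_\lambda:=|1-c_\lambda|\sqrt{1-\frac{b_\lambda^2}{4c_\lambda}}$ if $c_\lambda>0$ and $\frac{|b_\lambda|(1+c_\lambda)}{4c_\lambda}<1$, while $r_\lambda:=\big||1+c_\lambda|-|b_\lambda|\big|$ otherwise. $\arccos:[-1,1]\to[0,\pi]$. *)

(* Defs.v *)
From HB Require Import structures.
From mathcomp Require Import all_boot all_order all_algebra.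
From mathcomp Require Import all_classical all_reals all_analysis.
From mathcomp Require Import complex.

Set Implicit Arguments.
Unset Strict Implicit.
Unset Printing Implicit Defensive.

Import Order.TTheory GRing.Theory Num.Theory.
Import numFieldNormedType.Exports.
Import ComplexField.Normc.

Local Open Scope classical_set_scope.
Local Open Scope ring_scope.
Local Open Scope complex_scope.

(* [`|v|] on matrices is the max norm, hence explicit Euclidean norms. *)
Definition enorm (R : realType) (n : nat) (v : 'cV[R]_n) : R :=
  Num.sqrt (\sum_i v i 0 ^+ 2).

Definition cenorm (R : realType) (n : nat) (v : 'cV[R[i]]_n) : R :=
  Num.sqrt (\sum_i normc (v i 0) ^+ 2).

(* The spectral norm is the operator norm induced by the Euclidean norms. *)
Definition spectral_norm (R : realType) (m n : nat) (M : 'M[R[i]]_(m, n)) : R :=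
  sup [set cenorm (M *m v) | v in [set v : 'cV[R[i]]_n | cenorm v = 1]].

Definition complex_mx (R : realType) (m n : nat) (M : 'M[R]_(m, n)) :
    'M[R[i]]_(m, n) :=
  map_mx (real_complex R) M.

Definition spectral_radius (R : realType) (n : nat) (M : 'M[R]_n) : R :=
  sup [set normc a | a in [set a : R[i] | eigenvalue (complex_mx M) a]].

Definition posdef (R : realType) (n : nat) (Q : 'M[R]_n) : Prop :=
  Q^T = Q /\ forall x : 'cV[R]_n, x != 0 -> 0 < (x^T *m Q *m x) 0 0.

Definition is_smallest_eigenvalue (R : realType) (n : nat) (Q : 'M[R]_n)
    (a : R) : Prop :=
  eigenvalue Q a /\ forall b, eigenvalue Q b -> a <= b.

Definition is_largest_eigenvalue (R : realType) (n : nat) (Q : 'M[R]_n)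
    (a : R) : Prop :=
  eigenvalue Q a /\ forall b, eigenvalue Q b -> b <= a.

Definition ordered_eigendecomposition (R : realType) (n : nat) (Q U : 'M[R]_n)
    (lam : 'rV[R]_n) : Prop :=
  [/\ U^T *m U = 1%:M, Q = U *m diag_mx lam *m U^T
    & forall i j : 'I_n, (i <= j)%N -> lam 0 i <= lam 0 j].

Definition quadratic (R : realType) (d : nat) (Q : 'M[R]_d) (p : 'cV[R]_d)
    (r : R) (x : 'cV[R]_d) : R :=
  2^-1 * (x^T *m Q *m x) 0 0 + (p^T *m x) 0 0 + r.

Definition grad (R : realType) (d : nat) (f : 'cV[R]_d -> R) (x : 'cV[R]_d) :
    'cV[R]_d :=
  \col_i 'D_(delta_mx i 0) f x.

(* [gmm_state f alpha beta nu w x0 k] is the pair (x_k, x_(k-1)), with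
   x_(-1) = x_0 = x0. *)
Fixpoint gmm_state (R : realType) (d : nat) (f : 'cV[R]_d -> R)
    (alpha beta nu : R) (w : nat -> 'cV[R]_d) (x0 : 'cV[R]_d) (k : nat) :
    'cV[R]_d * 'cV[R]_d :=
  if k is j.+1 then
    let: (x, xp) := gmm_state f alpha beta nu w x0 j in
    let y := x + nu *: (x - xp) in
    (x - alpha *: (grad f y + w j) + beta *: (x - xp), x)
  else (x0, x0).

Definition gmm (R : realType) (d : nat) (f : 'cV[R]_d -> R)
    (alpha beta nu : R) (w : nat -> 'cV[R]_d) (x0 : 'cV[R]_d) (k : nat) :
    'cV[R]_d :=
  (gmm_state f alpha beta nu w x0 k).1.

Definition AQ (R : realType) (d : nat) (alpha beta nu : R) (Q : 'M[R]_d) :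
    'M[R]_(d + d) :=
  block_mx ((1 + beta)%:M - (alpha * (1 + nu)) *: Q)
           (- beta%:M + (alpha * nu) *: Q)
           1%:M 0.

Definition Bmx (R : realType) (d : nat) (alpha : R) : 'M[R]_(d + d, d) :=
  col_mx (- alpha%:M) 0.

Definition Tmx (R : realType) (d : nat) (U : 'M[R]_d) (lam : 'rV[R]_d) :
    'M[R]_(d, d + d) :=
  row_mx ((Num.sqrt 2)^-1 *: (diag_mx (map_mx Num.sqrt lam) *m U^T)) 0.

Definition output (R : realType) (d : nat) (f : 'cV[R]_d -> R)
    (alpha beta nu : R) (U : 'M[R]_d) (lam : 'rV[R]_d) (xs : 'cV[R]_d)
    (w : nat -> 'cV[R]_d) (x0 : 'cV[R]_d) (k : nat) : 'cV[R]_d :=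
  let: (x, xp) := gmm_state f alpha beta nu w x0 k in
  Tmx U lam *m col_mx (x - xs) (xp - xs).

(* Possibly infinite; a sequence is square-summable iff [sqsum v < +oo]. *)
Definition sqsum (R : realType) (d : nat) (v : nat -> 'cV[R]_d) : \bar R :=
  (\sum_(0 <= k <oo) (enorm (v k) ^+ 2)%:E)%E.

(* Junk value 0 when [v] is not square-summable. *)
Definition l2norm (R : realType) (d : nat) (v : nat -> 'cV[R]_d) : R :=
  Num.sqrt (fine (sqsum v)).

Definition total_gap (R : realType) (d : nat) (f : 'cV[R]_d -> R)
    (xs : 'cV[R]_d) (x : nat -> 'cV[R]_d) : \bar R :=
  (\sum_(0 <= k <oo) (f (x k) - f xs)%:E)%E.

Definition is_l2_gain_bound (R : realType) (d : nat) (f : 'cV[R]_d -> R)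
    (xs : 'cV[R]_d) (alpha beta nu gamma : R) : Prop :=
  exists H : 'cV[R]_d -> R,
    [/\ forall x, 0 <= H x, H xs = 0
      & forall (x0 : 'cV[R]_d) (w : nat -> 'cV[R]_d), (sqsum w < +oo)%E ->
          (total_gap f xs (gmm f alpha beta nu w x0)
             <= (gamma ^+ 2)%:E * sqsum w + (H x0)%:E)%E].

Definition L2star (R : realType) (d : nat) (f : 'cV[R]_d -> R)
    (xs : 'cV[R]_d) (alpha beta nu : R) : R :=
  inf [set gamma : R | 0 < gamma /\
                       is_l2_gain_bound f xs alpha beta nu gamma].

Definition transfer (R : realType) (d : nat) (alpha beta nu : R)
    (Q U : 'M[R]_d) (lam : 'rV[R]_d) (z : R[i]) : 'M[R[i]]_d :=
  complex_mx (Tmx U lam) *m invmx (z%:M - complex_mx (AQ alpha beta nu Q))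
    *m complex_mx (Bmx d alpha).

Definition Hinf (R : realType) (d : nat) (alpha beta nu : R)
    (Q U : 'M[R]_d) (lam : 'rV[R]_d) : R :=
  sup [set spectral_norm (transfer alpha beta nu Q U lam z)
      | z in [set z : R[i] | `|z| = 1]].

Definition b_ (R : realType) (alpha beta nu lambda : R) : R :=
  alpha * lambda * (1 + nu) - (1 + beta).

Definition c_ (R : realType) (alpha beta nu lambda : R) : R :=
  beta - alpha * lambda * nu.

Definition r_ (R : realType) (alpha beta nu lambda : R) : R :=
  let b := b_ alpha beta nu lambda in
  let c := c_ alpha beta nu lambda in
  if (0 < c) && (`|b| * (1 + c) / (4 * c) < 1)
  then `|1 - c| * Num.sqrt (1 - b ^+ 2 / (4 * c))
  else `| `|1 + c| - `|b| |.

Definition omega (R : realType) (alpha beta nu lambda : R) : R :=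
  let b := b_ alpha beta nu lambda in
  let c := c_ alpha beta nu lambda in
  if (0 < c) && (`|b * (1 + c)| < 4 * `|c|)
  then acos (- (b * (1 + c) / (4 * c)))
  else if (c <= 0) && ((1 - b + c) ^+ 2 <= (1 + b + c) ^+ 2) then pi
  else if (4 * `|c| <= `|b * (1 + c)|) &&
          ((1 - b + c) ^+ 2 <= (1 + b + c) ^+ 2) then pi
  else 0.

Definition worst_noise (R : realType) (d : nat) (om : R) (u : 'cV[R]_d)
    (h : R) (k : nat) : 'cV[R]_d :=
  (Num.sqrt (h * (2 - h)) * (1 - h) ^+ k * cos (om * k%:R)) *: u.

(* Main.v *)
Require Import Defs.
From HB Require Import structures.
From mathcomp Require Import all_boot all_order all_algebra.
From mathcomp Require Import all_classical all_reals all_analysis.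
From mathcomp Require Import complex.
From mathcomp Require Import ring lra.

(** Subtracting the minimizer and passing to an orthonormal eigenbasis of Q,
    the iteration splits into scalar recursions
    e_(k+1) + b e_k + c e_(k-1) = - alpha w_k, one per eigenvalue, with
    b = b_lambda and c = c_lambda; the gap f(x_k) - f(xs) is the sum of the
    lambda e_k^2 / 2.  Stability of A_Q says that the roots of z^2 + b z + c
    lie in the open unit disc, which is |c| < 1 and |b| < 1 + c
    ([jury_criterion], [stable_mode]).

    On the unit circle |z^2 + b z + c|^2 is a quadratic polynomial in
    t = Re z, and [rate b c] = r_lambda is the square root of its minimum over
    [-1, 1], attained at t = cos omega ([circle_gain_ge],
    [circle_gain_peak]).  Writing that polynomial minus its minimum as a sum
    of squares gives, in the time domain, a dissipation identity
    v_k^2 - r^2 e_k^2 = loss_k + S_(k+1) - S_k, with v the forcing, a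
    nonnegative loss and a positive semidefinite quadratic storage S.  Summing
    it ([energy_balance]) bounds r^2 times the energy of e by the energy of v
    plus the initial storage, at every finite horizon.  Hence
    gamma = (alpha / sqrt 2) max_lambda (sqrt lambda / r_lambda) is an l2 gain
    bound, and the storage at x_0 is a valid function H ([l2_gain_bound]).

    The bound is sharp because, for the damped cosine of frequency omega, the
    loss is negligible.  The loss is a quadratic form in a filter of e that
    annihilates cos (omega k), namely e_(k+1) - 2 t e_k + e_(k-1) in the
    resonant case and e_(k+1) - t e_k when t = 1 or t = -1.  The filtered e
    solves the same recursion, driven by the filtered noise, which is only O(h)
    relative to the noise, and the same gain estimate makes its energy O(h)
    ([noise_loss]).  The energy of the noise stays bounded away from 0, so the
    ratio of energies tends to alpha^2 / r^2 ([energy_ratio_cvg]).  This gives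
    the convergence, and also shows that no smaller gamma is an l2 gain bound.

    The maximum over the spectrum is reached at mu or L ([rate_between]).  For
    s = alpha lambda, r^2 / s is the minimum of an increasing function, a
    decreasing one, and, in the resonant range of parameters, of a function
    whose superlevel sets are convex in the plane of (s, c), where
    c = beta - nu s runs along a line.

    Finally the transfer matrix equals
    - (alpha z / sqrt 2) Lambda^(1/2) diag(1 / (z^2 + b z + c)) U^T
    ([resolvent_column], [transferE]), so that its spectral norm on the circle
    is the largest modulus of the diagonal entries, and the H-infinity norm is
    the same maximum, reached at exp(i omega) ([Hinf_max]). *)

Set Implicit Arguments.
Unset Strict Implicit.
Unset Printing Implicit Defensive.

Import Order.TTheory GRing.Theory Num.Theory.
Import numFieldNormedType.Exports.

Local Open Scope classical_set_scope.
Local Open Scope ring_scope.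

(** * Extremal gain of one eigenmode: storage and loss *)

Section Scalar.
Variable R : rcfType.
Implicit Types b c x y z t : R.

(** The Schur-Cohn-Jury form of the condition that both roots of z^2 + b z + c
    lie in the open unit disc; see [jury_criterion]. *)
Definition stable b c := (`|c| < 1) && (`|b| < 1 + c).

(** For stable b and c, the minimum of |z^2 + b z + c| over the unit circle is
    reached off the real axis: as a polynomial in Re z its square is convex, with
    vertex in ]-1, 1[. *)
Definition resonant b c := (0 < c) && (`|b| * (1 + c) < 4 * c).

(** For stable b and c, the minimum of |z^2 + b z + c| over the unit circle. *)
Definition rate b c :=
  if resonant b c then `|1 - c| * Num.sqrt (1 - b ^+ 2 / (4 * c))
  else `| `|1 + c| - `|b| |.

(** For stable b and c, the real part of a point of the unit circle where
    |z^2 + b z + c| is least. *)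
Definition peak_cos b c :=
  if resonant b c then - (b * (1 + c) / (4 * c))
  else if 0 <= b then -1 else 1.

(** A solution of the Kalman-Yakubovich-Popov inequality for the supply rate
    (x + b y + c z)^2 - rate^2 y^2.  In the resonant case it is the only one; in
    the other case it is chosen so that the loss is symmetric under reversal of
    time, which keeps its coefficients polynomial in b, c and |b|. *)
Definition storage b c x y :=
  if resonant b c then (1 - c) * (x ^+ 2 + b * x * y + c * y ^+ 2)
  else 2^-1 * ((1 + c) * (2 - `|b|) * x ^+ 2 + 2 * b * (1 - c) * x * y
               + (1 + c) * (`|b| - 2 * c) * y ^+ 2).

Definition loss b c x y z :=
  (x + b * y + c * z) ^+ 2 - rate b c ^+ 2 * y ^+ 2
  - (storage b c x y - storage b c y z).

Lemma stableP b c : stable b c -> [/\ -1 < c, c < 1, b < 1 + c & - b < 1 + c].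
Proof. by rewrite /stable !ltr_norml => /andP[/andP[? ?] /andP[? ?]]; split; lra. Qed.

Lemma resonantP b c : resonant b c ->
  [/\ 0 < c, b * (1 + c) < 4 * c & - b * (1 + c) < 4 * c].
Proof.
case/andP=> c0 h; have := ler_norm b; have := ler_norm (- b); rewrite normrN.
by split=> //; nra.
Qed.

(** Resonance bounds b^2 (1 + c)^2 by (4 c)^2, and 4 c <= (1 + c)^2. *)
Lemma resonant_disc b c : stable b c -> resonant b c -> b ^+ 2 < 4 * c.
Proof.
move=> /stableP[c1 c2 b1 b2] /resonantP[c0 h1 h2].
have : (b * (1 + c)) ^+ 2 < (4 * c) ^+ 2.
  by rewrite -subr_gt0 subr_sqr mulr_gt0 //; lra.
move=> h.
have h3 : (4 * c) ^+ 2 <= 4 * c * (1 + c) ^+ 2.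
  have := sqr_ge0 (1 - c); nra.
have h4 : 0 < (1 + c) ^+ 2 by rewrite exprn_gt0 //; lra.
by rewrite -(ltr_pM2r h4) -exprMn; apply: lt_le_trans h h3.
Qed.

Lemma rate_resonant b c : stable b c -> resonant b c ->
  rate b c ^+ 2 = (1 - c) ^+ 2 * (1 - b ^+ 2 / (4 * c)).
Proof.
move=> st re; have d := resonant_disc st re; rewrite /rate re.
case/stableP: st => c1 c2 b1 b2; case/resonantP: re => c0 h1 h2.
rewrite exprMn real_normK ?num_real // sqr_sqrtr // subr_ge0.
by rewrite ler_pdivrMr; lra.
Qed.

Lemma rate_nonresonant b c : stable b c -> ~~ resonant b c -> rate b c = 1 + c - `|b|.
Proof.
move=> /andP[]; rewrite ltr_norml => /andP[c1 c2] bc /negbTE re.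
rewrite /rate re (@gtr0_norm _ (1 + c)); last lra.
by rewrite gtr0_norm // subr_gt0.
Qed.

Lemma rate_gt0 b c : stable b c -> 0 < rate b c.
Proof.
move=> st; case: (boolP (resonant b c)) => re; last first.
  by rewrite rate_nonresonant // subr_gt0; case/andP: st.
have d := resonant_disc st re; rewrite /rate re.
case/stableP: st => c1 c2 b1 b2; case/resonantP: re => c0 h1 h2.
rewrite mulr_gt0 ?sqrtr_gt0 ?normr_gt0 ?subr_gt0; [|by rewrite subr_eq0 gt_eqF|].
  by [].
by rewrite ltr_pdivrMr; lra.
Qed.

(** The values of |z^2 + b z + c| at z = 1 and z = -1 are 1 + c + b and
    1 + c - b, and the rate is a minimum over the whole circle. *)
Lemma rate_le_endpoint b c : stable b c -> rate b c ^+ 2 <= (1 + c - `|b|) ^+ 2.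
Proof.
move=> st; case: (boolP (resonant b c)) => re; last by rewrite rate_nonresonant.
rewrite rate_resonant //; move: (st) => /andP[_ hb].
case/stableP: st => c1 c2 b1 b2; case/andP: re => c0 h1.
have -> : b ^+ 2 = `|b| ^+ 2 by rewrite real_normK ?num_real.
move: hb h1 (normr_ge0 b); move: `|b| => a hb h1 a0.
rewrite -subr_ge0.
suff -> : (1 + c - a) ^+ 2 - (1 - c) ^+ 2 * (1 - a ^+ 2 / (4 * c))
   = (a * (1 + c) - 4 * c) ^+ 2 / (4 * c) by rewrite divr_ge0 ?sqr_ge0 //; lra.
by field; lra.
Qed.

(** Half of the right-hand side is the diagonal coefficient of the loss in
    [loss_nonresonant], and c is its off-diagonal one: this is what makes the
    loss positive semidefinite. *)
Lemma nonresonant_gap b c : stable b c -> ~~ resonant b c ->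
  2 * `|c| <= `|b| * (1 + c) - 2 * c.
Proof.
case/stableP => c1 c2 b1 b2; rewrite negb_and -leNgt -leNgt.
have := normr_ge0 b; move: `|b| => a a0.
case/orP => h; first by rewrite ler0_norm //; nra.
by case: (ger0P c) => c0; nra.
Qed.

Lemma binary_form_ge0 (u v w : R) x y : 0 <= u -> 0 <= w -> v ^+ 2 <= u * w ->
  0 <= u * x ^+ 2 + 2 * v * x * y + w * y ^+ 2.
Proof.
rewrite le0r => /orP[/eqP-> w0|u0 w0 h].
  rewrite mul0r => v0; have -> : v = 0 by apply/eqP; rewrite -sqrf_eq0 eq_le v0 sqr_ge0.
  by rewrite mulr0 !mul0r !add0r mulr_ge0 ?sqr_ge0.
rewrite -(pmulr_rge0 _ u0).
have -> : u * (u * x ^+ 2 + 2 * v * x * y + w * y ^+ 2) =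
  (u * x + v * y) ^+ 2 + (u * w - v ^+ 2) * y ^+ 2 by ring.
by rewrite addr_ge0 ?sqr_ge0 // mulr_ge0 ?sqr_ge0 // subr_ge0.
Qed.

(** Outside the resonant case the determinant of the form is a multiple of
    (1 + c - |b|) ((1 + c^2) |b| - 2 c (1 + c)); stability gives the sign of the
    first factor, nonresonance that of the second. *)
Lemma storage_ge0 b c x y : stable b c -> 0 <= storage b c x y.
Proof.
move=> st; rewrite /storage; case: ifPn => re.
  have d := resonant_disc st re.
  case/stableP: st => c1 c2 b1 b2; case/resonantP: re => c0 _ _.
  apply: mulr_ge0; first lra.
  have := @binary_form_ge0 1 (b / 2) c x y ler01 (ltW c0).
  rewrite !mul1r => h; apply: le_trans (h _) _; first by lra.
  by rewrite le_eqVlt; apply/orP; left; apply/eqP; field.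
have e := nonresonant_gap st re; move: (st) => /andP[_ hb].
case/stableP: st => c1 c2 b1 b2.
have b2E : b ^+ 2 = `|b| ^+ 2 by rewrite real_normK ?num_real.
have n0 := normr_ge0 b; have k1 := ler_norm c.
have k2 := ler_norm (- c); rewrite normrN in k2.
have P := @binary_form_ge0 ((1 + c) * (2 - `|b|)) (b * (1 - c)) ((1 + c) * (`|b| - 2 * c)) x y.
apply: mulr_ge0; first by rewrite invr_ge0.
rewrite (mulrA 2 b) in P; apply: P.
- by apply: mulr_ge0; lra.
- apply: mulr_ge0; first lra.
  by move: `|b| `|c| e hb n0 k1 k2 {b1 b2 b2E} => a k; nra.
rewrite exprMn b2E.
move: `|b| `|c| e hb n0 k1 k2 {b1 b2 b2E} => a k e hb n0 k1 k2.
rewrite -subr_ge0.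
have -> : (1 + c) * (2 - a) * ((1 + c) * (a - 2 * c)) - a ^+ 2 * (1 - c) ^+ 2
  = 2 * (1 + c - a) * ((1 + c ^+ 2) * a - 2 * c * (1 + c)) by ring.
apply: mulr_ge0; first lra.
nra.
Qed.

Lemma storage_le b c x y : stable b c -> storage b c x y <= 16 * (x ^+ 2 + y ^+ 2).
Proof.
move=> st; have xy1 := sqr_ge0 (x - y); have xy2 := sqr_ge0 (x + y).
have x0 := sqr_ge0 x; have y0 := sqr_ge0 y.
rewrite /storage; case: ifPn => re; last first.
  move: (st) => /andP[_ hb]; case/stableP: st => c1 c2 b1 b2.
  have n0 := normr_ge0 b.
  have B1 : (1 + c) * (2 - `|b|) * x ^+ 2 <= 4 * x ^+ 2.
    by apply: ler_wpM2r => //; nra.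
  have B2 : (1 + c) * (`|b| - 2 * c) * y ^+ 2 <= 8 * y ^+ 2.
    by apply: ler_wpM2r => //; nra.
  have b3 : b * (1 - c) <= 4 by nra.
  have b4 : - (b * (1 - c)) <= 4 by nra.
  have B3 : 2 * b * (1 - c) * x * y <= 4 * (x ^+ 2 + y ^+ 2) by nra.
  lra.
case/stableP: st => c1 c2 b1 b2; case/resonantP: re => c0 _ _.
have B3 : b * x * y <= x ^+ 2 + y ^+ 2 by nra.
have B2 : c * y ^+ 2 <= y ^+ 2 by nra.
nra.
Qed.

(** Outside the resonant case the extremal point is real, on the side opposite
    to the sign of b. *)
Lemma peak_cos_nonresonant b c : ~~ resonant b c ->
  peak_cos b c ^+ 2 = 1 /\ b = - peak_cos b c * `|b|.
Proof.
move=> re; rewrite /peak_cos (negbTE re); case: ger0P => b0.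
  by rewrite sqrrN expr1n opprK mul1r.
by rewrite expr1n mulrN mulN1r opprK.
Qed.

Lemma peak_cos_bound b c : stable b c -> -1 <= peak_cos b c <= 1.
Proof.
move=> st; rewrite /peak_cos; case: ifPn => re.
  case/stableP: st => c1 c2 b1 b2; case/resonantP: re => c0 h1 h2.
  by rewrite -mulNr ler_pdivlMr ?ler_pdivrMr; lra.
by case: ifP => _; lra.
Qed.

(** At the double zero t of circle_gain - rate^2 the loss is the square of the
    second-order filter that annihilates cos (omega k) for t = cos omega. *)
Lemma loss_resonant b c x y z : stable b c -> resonant b c ->
  loss b c x y z = c * (x - 2 * peak_cos b c * y + z) ^+ 2.
Proof.
move=> st re; rewrite /loss rate_resonant // /storage /peak_cos re.
by case/resonantP: re => c0 _ _; field; lra.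
Qed.

(** The loss is a form in the values x - t y and z - t y of the first-order
    filter that annihilates t^k; time reversal exchanges them as t^2 = 1. *)
Lemma loss_nonresonant b c x y z (t := peak_cos b c)
    (A := (`|b| * (1 + c) - 2 * c) / 2) : stable b c -> ~~ resonant b c ->
  loss b c x y z = A * (x - t * y) ^+ 2
    + 2 * c * (x - t * y) * (z - t * y) + A * (z - t * y) ^+ 2.
Proof.
move=> st re; rewrite /loss rate_nonresonant // /storage (negbTE re) /A /t.
have [t2 bE] := peak_cos_nonresonant re; move: t2 bE.
move: (peak_cos b c) `|b| => {A}{}t a t2 ->.
by field: t2.
Qed.

Lemma loss_nonresonant_bounds b c x y z (t := peak_cos b c) :
  stable b c -> ~~ resonant b c ->
  0 <= loss b c x y z <= 6 * ((x - t * y) ^+ 2 + (z - t * y) ^+ 2).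
Proof.
move=> st re; rewrite loss_nonresonant // -/t.
move: (x - t * y) (z - t * y) => p q.
have e := nonresonant_gap st re; move: (st) => /andP[_ hb].
case/stableP: st => c1 c2 b1 b2.
set A := _ / 2; have n0 := normr_ge0 b.
have A1 : `|c| <= A by rewrite /A; lra.
have A2 : A <= 3 by rewrite /A; nra.
have pq1 := sqr_ge0 (p - q); have pq2 := sqr_ge0 (p + q).
have p0 := sqr_ge0 p; have q0 := sqr_ge0 q.
have k1 := ler_norm c; have k2 := ler_norm (- c); rewrite normrN in k2.
have B : (A - c) * (p - q) ^+ 2 + (A + c) * (p + q) ^+ 2
  = 2 * (A * p ^+ 2 + 2 * c * p * q + A * q ^+ 2) by ring.
have B' : (A - c) * (p - q) ^+ 2 + (A + c) * (p + q) ^+ 2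
   <= 6 * (p - q) ^+ 2 + 6 * (p + q) ^+ 2.
  by apply: lerD; apply: ler_wpM2r => //; lra.
have B0 : 0 <= (A - c) * (p - q) ^+ 2 + (A + c) * (p + q) ^+ 2.
  by apply: addr_ge0; apply: mulr_ge0 => //; lra.
apply/andP; split; first lra.
have : 6 * (p - q) ^+ 2 + 6 * (p + q) ^+ 2 = 12 * (p ^+ 2 + q ^+ 2) by ring.
lra.
Qed.

Lemma loss_ge0 b c x y z : stable b c -> 0 <= loss b c x y z.
Proof.
move=> st; case: (boolP (resonant b c)) => re; last first.
  by case/andP: (loss_nonresonant_bounds x y z st re).
rewrite loss_resonant // mulr_ge0 ?sqr_ge0 //.
by case/resonantP: re => /ltW.
Qed.

(** This is |z^2 + b z + c|^2 for |z| = 1 and Re z = t; see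
    [normc_mode_poly]. *)
Definition circle_gain b c t :=
  (1 - c) ^+ 2 + b ^+ 2 + 2 * b * (1 + c) * t + 4 * c * t ^+ 2.

Lemma circle_gain_peak b c : stable b c ->
  circle_gain b c (peak_cos b c) = rate b c ^+ 2.
Proof.
move=> st; rewrite /circle_gain; case: (boolP (resonant b c)) => re.
  rewrite rate_resonant // /peak_cos re; case/resonantP: re => c0 _ _.
  by field; lra.
rewrite rate_nonresonant //; have [t2 bE] := peak_cos_nonresonant re; rewrite t2.
have b2E : b ^+ 2 = `|b| ^+ 2 by rewrite real_normK ?num_real.
have btE : b * peak_cos b c = - `|b|.
  by rewrite {1}bE mulrAC mulNr -expr2 t2 mulN1r.
rewrite b2E -!mulrA (mulrCA b) btE; ring.
Qed.

Lemma circle_gain_ge b c t : stable b c -> -1 <= t <= 1 ->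
  rate b c ^+ 2 <= circle_gain b c t.
Proof.
move=> st /andP[t1 t2]; rewrite -circle_gain_peak // -subr_ge0.
rewrite /circle_gain; case: (boolP (resonant b c)) => re.
  rewrite /peak_cos re; case/resonantP: re => c0 _ _.
  set X := (X in 0 <= X).
  have -> : X = 4 * c * (t + b * (1 + c) / (4 * c)) ^+ 2.
    by rewrite /X; field; lra.
  by rewrite mulr_ge0 ?sqr_ge0 //; lra.
have [p2 bE] := peak_cos_nonresonant re; have e := nonresonant_gap st re.
rewrite p2; move: (peak_cos b c) p2 bE => p p2 bE.
case/stableP: st => c1 c2 _ _.
have k1 := ler_norm c; have k2 := ler_norm (- c); rewrite normrN in k2.
set X := (X in 0 <= X).
have -> : X = (1 - p * t) * (2 * `|b| * (1 + c) - 4 * c * (1 + p * t)).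
  by rewrite /X; move: `|b| bE => a ->; ring: p2.
have /orP[/eqP pE|/eqP pE] : (p == 1) || (p == -1) by rewrite -eqf_sqr p2 expr1n.
  by rewrite pE; apply: mulr_ge0; nra.
by rewrite pE; apply: mulr_ge0; nra.
Qed.
End Scalar.

(** * Energy estimates for the scalar recursion *)

Section Energy.
Variable R : rcfType.
Implicit Types (b c h t : R) (E C : nat -> R).

(** The storage telescopes in the definition of the loss. *)
Lemma energy_balance b c E N :
  rate b c ^+ 2 * (\sum_(k < N) E k.+1 ^+ 2)
  + \sum_(k < N) loss b c (E k.+2) (E k.+1) (E k) + storage b c (E N.+1) (E N)
  = \sum_(k < N) (E k.+2 + b * E k.+1 + c * E k) ^+ 2 + storage b c (E 1) (E 0).
Proof.
elim: N => [|N IH]; first by rewrite !big_ord0 mulr0 !add0r.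
rewrite !big_ord_recr /= mulrDr.
rewrite addrAC (addrC _ (rate b c ^+ 2 * E N.+1 ^+ 2)).
have -> : \sum_(i < N) (E i.+2 + b * E i.+1 + c * E i) ^+ 2
  + (E N.+2 + b * E N.+1 + c * E N) ^+ 2 + storage b c (E 1) (E 0)
  = (rate b c ^+ 2 * (\sum_(k < N) E k.+1 ^+ 2)
  + \sum_(k < N) loss b c (E k.+2) (E k.+1) (E k) + storage b c (E N.+1) (E N)) +
   (E N.+2 + b * E N.+1 + c * E N) ^+ 2 by rewrite IH addrAC.
by rewrite /loss; ring.
Qed.

(** Both the loss and the final storage are nonnegative, so the estimate holds
    at every horizon, with no decay of E. *)
Lemma energy_gain b c E N : stable b c ->
  rate b c ^+ 2 * (\sum_(k < N) E k.+1 ^+ 2)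
  <= \sum_(k < N) (E k.+2 + b * E k.+1 + c * E k) ^+ 2 + storage b c (E 1) (E 0).
Proof.
move=> st; rewrite -energy_balance -addrA lerDl addr_ge0 ?storage_ge0 //.
by apply: sumr_ge0 => k _; apply: loss_ge0.
Qed.

(** The factor h (2 - h) = 1 - (1 - h)^2 normalizes the geometric series. *)
Lemma geometric_energy h N :
  (h * (2 - h)) * (\sum_(k < N) ((1 - h) ^+ k) ^+ 2) = 1 - ((1 - h) ^+ N) ^+ 2.
Proof.
elim: N => [|N IH]; first by rewrite big_ord0 expr0; ring.
by rewrite big_ord_recr mulrDr IH [(1 - h) ^+ N.+1]exprS /=; ring.
Qed.

Lemma geometric_energy_le h N :
  (h * (2 - h)) * (\sum_(k < N) ((1 - h) ^+ k) ^+ 2) <= 1.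
Proof. by rewrite geometric_energy lerBlDr lerDl sqr_ge0. Qed.

(** The three-term recursion of cos (omega k) with t = cos omega; nothing else
    about the cosine enters the energy estimates. *)
Definition cosine_like t C :=
  [/\ C 0 = 1, C 1 = t & forall k, C k.+2 = 2 * t * C k.+1 - C k].

(** A conserved quantity of the recursion, in place of
    cos^2 + sin^2 = 1. *)
Lemma cosine_invariant t C k : cosine_like t C ->
  C k.+1 ^+ 2 - 2 * t * C k.+1 * C k + C k ^+ 2 = 1 - t ^+ 2.
Proof.
case=> C0 C1 CS; elim: k => [|k IH]; first by rewrite C0 C1; ring.
by rewrite -IH CS; ring.
Qed.

(** For t = 1 or t = -1 the sequence is t^k, so a first-order filter
    annihilates it. *)
Lemma cosine_sign t C k : cosine_like t C -> t ^+ 2 = 1 -> C k.+1 = t * C k.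
Proof.
case=> C0 C1 CS t2; elim: k => [|k IH]; first by rewrite C0 C1 mulr1.
by rewrite CS IH; ring: t2.
Qed.

Lemma cosine_le1 t C k : cosine_like t C -> -1 <= t <= 1 -> C k ^+ 2 <= 1.
Proof.
move=> hC ht; have [t2|t2] := eqVneq (t ^+ 2) 1.
  elim: k => [|k IH]; first by case: hC => -> _ _; rewrite expr1n.
  by rewrite (cosine_sign k hC t2) exprMn t2 mul1r.
have I := cosine_invariant k hC.
have t20 : 0 < 1 - t ^+ 2.
  by rewrite subr_gt0 lt_neqAle t2 /=; nra.
rewrite -(ler_pM2l t20) mulr1 -I.
by have := sqr_ge0 (C k.+1 - t * C k); nra.
Qed.

(** Two consecutive samples of a cosine cannot both be small: otherwise so
    would be the invariant 1 - t^2.  This keeps the energy of the noise away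
    from 0. *)
Lemma cosine_pair t C : cosine_like t C -> -1 <= t <= 1 ->
  exists2 m, 0 < m & forall k, m <= C k ^+ 2 + C k.+1 ^+ 2.
Proof.
move=> hC ht; have [t2|t2] := eqVneq (t ^+ 2) 1.
  have C2 k : C k ^+ 2 = 1.
    elim: k => [|k IH]; first by case: hC => -> _ _; rewrite expr1n.
    by rewrite (cosine_sign k hC t2) exprMn t2 mul1r.
  by exists 1 => // k; rewrite !C2; lra.
exists ((1 - t ^+ 2) / 2) => [|k].
  by rewrite divr_gt0 // subr_gt0 lt_neqAle t2 /=; nra.
rewrite -(cosine_invariant k hC) ler_pdivrMr //.
move: (C k) (C k.+1) => x y.
have := sqr_ge0 (x - y); have := sqr_ge0 (x + y).
case/andP: ht => h1 h2 k1 k2.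
have : (1 - t) * (x + y) ^+ 2 + (1 + t) * (x - y) ^+ 2 >= 0.
  by apply: addr_ge0; apply: mulr_ge0; lra.
have : 0 <= x ^+ 2 + y ^+ 2 by rewrite addr_ge0 ?sqr_ge0.
nra.
Qed.

(** A sequence with small initial values and small forcing has small energy, by
    the gain estimate itself. *)
Lemma filtered_energy b c : stable b c -> exists2 K : R, 0 < K &
  forall (g : nat -> R) h F, 0 < h < 1 -> 0 <= F ->
  g 0 ^+ 2 <= F * h -> g 1 ^+ 2 <= F * h ->
  (forall k, (g k.+2 + b * g k.+1 + c * g k) ^+ 2
      <= F * h * (h * (2 - h)) * ((1 - h) ^+ k) ^+ 2) ->
  forall N, \sum_(k < N) g k ^+ 2 <= K * F * h.
Proof.
move=> st; have r0 : 0 < rate b c ^+ 2 by rewrite exprn_gt0 ?rate_gt0.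
(* 33 = 1 + 16 * 2: the forcing, and the storage of the two initial values. *)
exists (1 + 33 / rate b c ^+ 2) => [|g h F hh F0 g0 g1 gk N].
  by rewrite addr_gt0 // divr_gt0.
have G : \sum_(k < N) (g k.+2 + b * g k.+1 + c * g k) ^+ 2 <= F * h.
  apply: (@le_trans _ _ (F * h * ((h * (2 - h)) * \sum_(k < N) ((1 - h) ^+ k) ^+ 2))).
    by rewrite !mulr_sumr; apply: ler_sum => k _; rewrite mulrA; apply: gk.
  by apply: ler_piMr; [rewrite mulr_ge0 //; lra|apply: geometric_energy_le].
have S := energy_gain g N st; have s1 := storage_le (g 1) (g 0) st.
have G1 : rate b c ^+ 2 * \sum_(k < N) g k.+1 ^+ 2 <= 33 * (F * h) by lra.
have -> : (1 + 33 / rate b c ^+ 2) * F * h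
   = F * h + 33 * (F * h) / rate b c ^+ 2 by ring.
apply: (@le_trans _ _ (g 0 ^+ 2 + \sum_(k < N) g k.+1 ^+ 2)).
  case: N {G S G1} => [|N]; first by rewrite !big_ord0 addr0 sqr_ge0.
  rewrite big_ord_recl lerD2l big_ord_recr /= lerDl.
  exact: sqr_ge0.
by apply: lerD => //; rewrite ler_pdivlMr // mulrC.
Qed.

(** The filter g of E that carries the loss solves the recursion of E with the
    filtered noise as forcing.  The filter annihilates C, so only the damping
    1 - h leaves something, of relative size h; the normalization
    sqrt (h (2 - h)) makes the initial values of g of size sqrt h. *)
Lemma noise_loss b c (t := peak_cos b c) C A : stable b c -> cosine_like t C ->
  exists2 K : R, 0 <= K & forall E h, 0 < h < 1 -> E 0 = 0 -> E 1 = 0 ->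
  (forall k, E k.+2 + b * E k.+1 + c * E k
     = A * (Num.sqrt (h * (2 - h)) * (1 - h) ^+ k * C k)) ->
  forall N, \sum_(k < N) loss b c (E k.+2) (E k.+1) (E k) <= K * h.
Proof.
move=> st hC; have [K K0 HK] := filtered_energy st.
have ht := peak_cos_bound st; rewrite -/t in ht; have [c1 c2 b1 b2] := stableP st.
have KA : 0 <= K * (50 * A ^+ 2) by rewrite pmulr_rge0 // pmulr_rge0 // sqr_ge0.
(* 50 = 2 * 5 ^ 2, since the initial values of g are at most 5 |A| a with
   a ^ 2 <= 2 h; 12 = 6 + 6 comes from the two shifts of g in the
   nonresonant loss. *)
exists (12 * (K * (50 * A ^+ 2))) => [|E h hh E0 E1 Er N].
  by rewrite pmulr_rge0.
set a := Num.sqrt _ in Er; have /andP[h0 h1] := hh.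
have a2 : a ^+ 2 = h * (2 - h) by rewrite sqr_sqrtr // mulr_ge0; lra.
have a2h : a ^+ 2 <= 2 * h by rewrite a2; nra.
have A50 : 0 <= 50 * A ^+ 2 by rewrite pmulr_rge0 // sqr_ge0.
have Ah : 0 <= A ^+ 2 * h by rewrite mulr_ge0 ?sqr_ge0 ?ltW.
have A0 := sqr_ge0 A; have a0 := sqr_ge0 a.
have C2 k : C k ^+ 2 <= 1 by apply: cosine_le1 hC ht.
have [hC0 hC1 hCS] := hC.
have E2 : E 2 = A * a by have := Er 0; rewrite E0 E1 hC0 expr0; lra.
have hh2 : h ^+ 2 <= h by rewrite expr2; nra.
have Aa : (A * a) ^+ 2 <= 2 * A ^+ 2 * h by rewrite exprMn; nra.
case: (boolP (resonant b c)) => re.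
  pose g k := E k.+2 - 2 * t * E k.+1 + E k.
  have g0 : g 0 = A * a by rewrite /g E0 E1 E2; ring.
  have g1 : g 1 = A * a * ((1 - h) * t - b - 2 * t).
    have := Er 1; rewrite /g E1 E2 hC1 expr1 => e.
    have -> : E 3 = A * (a * (1 - h) * t) - b * (A * a) by lra.
    by ring.
  have G : \sum_(k < N) g k ^+ 2 <= K * (50 * A ^+ 2) * h.
    apply: HK => //.
    - by rewrite g0; lra.
    - rewrite g1 exprMn.
      have q : ((1 - h) * t - b - 2 * t) ^+ 2 <= 25.
        have [t1 t1'] := andP ht; have ht1 : h * t <= 1 by nra.
        have ht2 : -1 <= h * t by nra.
        have -> : 25 = 5 ^+ 2 :> R by ring.
        rewrite -subr_ge0 subr_sqr; apply: mulr_ge0; lra.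
      apply: (le_trans (ler_wpM2l (sqr_ge0 _) q)); lra.
    move=> k; have -> : g k.+2 + b * g k.+1 + c * g k
        = (A * a) * (h * (C k - (1 - h) * C k.+2)) * (1 - h) ^+ k.
      transitivity ((E k.+4 + b * E k.+3 + c * E k.+2)
        - 2 * t * (E k.+3 + b * E k.+2 + c * E k.+1)
        + (E k.+2 + b * E k.+1 + c * E k)); first by rewrite /g; ring.
      rewrite !Er !(exprS (1 - h)).
      have -> : C k.+2 = 2 * t * C k.+1 - C k by [].
      ring.
    rewrite exprMn [X in X * _ <= _]exprMn.
    apply: ler_wpM2r; first exact: sqr_ge0.
    rewrite [(h * _) ^+ 2]exprMn.
    have q : (C k - (1 - h) * C k.+2) ^+ 2 <= 4.
      have := C2 k; have := C2 k.+2; move: (C k) (C k.+2) => x y y2 x2.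
      have : (x - (1 - h) * y) ^+ 2 <= 2 * (x ^+ 2 + ((1 - h) * y) ^+ 2).
        by have := sqr_ge0 (x + (1 - h) * y); lra.
      have : ((1 - h) * y) ^+ 2 <= 1.
        by rewrite exprMn -[leRHS]mulr1 ler_pM ?sqr_ge0 // expr2; nra.
      lra.
    rewrite exprMn a2; set B := A ^+ 2 * _.
    have -> : 50 * A ^+ 2 * h * (h * (2 - h)) = B * (50 * h) by rewrite /B; ring.
    apply: ler_wpM2l; first by rewrite mulr_ge0 // mulr_ge0; lra.
    apply: (@le_trans _ _ (h * 4)); last lra.
    by apply: ler_pM; rewrite ?sqr_ge0.
  apply: (@le_trans _ _ (\sum_(k < N) g k ^+ 2)).
    apply: ler_sum => k _; rewrite loss_resonant // -/t.
    by apply: ler_piMl; [exact: sqr_ge0|lra].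
  apply: (le_trans G); apply: ler_wpM2r; first lra.
  lra.
have [t2 _] := peak_cos_nonresonant re; rewrite -/t in t2.
pose g k := E k.+1 - t * E k.
have g0 : g 0 = 0 by rewrite /g E0 E1; ring.
have g1 : g 1 = A * a by rewrite /g E1 E2; ring.
have G n : \sum_(k < n) g k ^+ 2 <= K * (50 * A ^+ 2) * h.
  apply: HK => //.
  - by rewrite g0 expr2 mulr0 mulr_ge0 // ltW.
  - by rewrite g1; lra.
  move=> k; have -> : g k.+2 + b * g k.+1 + c * g k
      = (A * a) * (- h * t * C k) * (1 - h) ^+ k.
    transitivity ((E k.+3 + b * E k.+2 + c * E k.+1)
      - t * (E k.+2 + b * E k.+1 + c * E k)); first by rewrite /g; ring.
    by rewrite !Er !(exprS (1 - h)) (cosine_sign k hC t2); ring.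
  rewrite exprMn [X in X * _ <= _]exprMn.
  apply: ler_wpM2r; first exact: sqr_ge0.
  rewrite exprMn a2; set B := A ^+ 2 * _.
  have -> : 50 * A ^+ 2 * h * (h * (2 - h)) = B * (50 * h) by rewrite /B; ring.
  apply: ler_wpM2l; first by rewrite mulr_ge0 // mulr_ge0; lra.
  rewrite mulNr mulNr sqrrN !exprMn t2 mulr1.
  apply: (@le_trans _ _ (h * 1)); last lra.
  by apply: ler_pM; rewrite ?sqr_ge0.
set S := K * _ * h in G.
apply: (@le_trans _ _ (\sum_(k < N) (6 * g k.+1 ^+ 2 + 6 * g k ^+ 2))).
  apply: ler_sum => k _; have := loss_nonresonant_bounds (E k.+2) (E k.+1) (E k) st re.
  case/andP=> _ /le_trans; apply; rewrite -/t mulrDr.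
  have -> : (E k - t * E k.+1) ^+ 2 = g k ^+ 2 by rewrite /g; ring: t2.
  by [].
rewrite big_split /= -!mulr_sumr.
have G1 : \sum_(k < N) g k.+1 ^+ 2 <= S.
  by apply: le_trans (G N.+1); rewrite big_ord_recl g0 expr0n add0r.
by have := G N; rewrite /S in G1 *; lra.
Qed.
End Energy.

(** * The extremal gain is largest at an end of the spectrum *)

Section Endpoints.
Variable R : realType.
Implicit Types M s c beta nu : R.

(** The condition M s <= rate^2 in the resonant range, rewritten as
    |s + c - 1| <= 2 sqrt (s (c - M c / (1 - c)^2)).  Since s and
    c - M c / (1 - c)^2 are concave and the geometric mean is concave and
    monotone, it defines a convex set of (s, c). *)
Definition lens M s c := (s + c - 1) ^+ 2 <= 4 * s * (c - M * (c / (1 - c) ^+ 2)).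

Lemma lensE M s c (b := s - 1 - c) : c < 1 ->
  lens M s c = (4 * c * (M * s) <= (1 - c) ^+ 2 * (4 * c - b ^+ 2)).
Proof.
move=> c1; have y0 : 0 < (1 - c) ^+ 2 by rewrite exprn_gt0 //; lra.
rewrite /lens -(ler_pM2r y0) -[RHS]subr_ge0 -[LHS]subr_ge0; congr (0 <= _).
by rewrite /b; field; lra.
Qed.

Lemma lens_resonant M s c (b := s - 1 - c) : stable b c -> resonant b c ->
  lens M s c = (M * s <= rate b c ^+ 2).
Proof.
move=> st re; rewrite rate_resonant // lensE; last by case/stableP: st.
case/resonantP: re => c0 _ _.
rewrite -[RHS](@ler_pM2l _ (4 * c)); last lra.
by congr (_ <= _); rewrite -/b; field; lra.
Qed.

(** On the boundary of the resonant range the interior minimum and the endpoint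
    minimum 1 + c - |b| agree. *)
Lemma lens_boundary M s c (b := s - 1 - c) : stable b c ->
  `|b| * (1 + c) = 4 * c ->
  M * s <= (1 + c - `|b|) ^+ 2 -> lens M s c.
Proof.
move=> st e hM; rewrite lensE -/b; last by case/stableP: st.
move/stableP: st => [c1 c2 b1 b2].
have b2E : b ^+ 2 = `|b| ^+ 2 by rewrite real_normK ?num_real.
rewrite {}b2E; move: `|b| (normr_ge0 b) e hM => a a0 e hM.
have c0 : 0 <= c by nra.
have aE : a = 4 * c / (1 + c) by rewrite -e; field; lra.
apply: (le_trans (ler_wpM2l _ hM)); first lra.
rewrite le_eqVlt; apply/orP; left; apply/eqP; rewrite aE; field; lra.
Qed.

(** Convexity of c / (1 - c)^2 on [0, 1[, as a tangent inequality: the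
    difference of the two sides is a nonnegative multiple of (c - c0)^2. *)
Lemma ratio_tangent c c0 : 0 <= c < 1 -> 0 <= c0 < 1 ->
  c0 / (1 - c0) ^+ 2 + (1 + c0) / (1 - c0) ^+ 3 * (c - c0) <= c / (1 - c) ^+ 2.
Proof.
move=> /andP[h1 h2] /andP[h3 h4]; rewrite -subr_ge0.
set X := (X in 0 <= X).
have -> : X = (c - c0) ^+ 2 * ((1 - c0) + (1 + c0) * (1 - c))
   / ((1 - c) ^+ 2 * (1 - c0) ^+ 3).
  by rewrite /X; field; lra.
apply: divr_ge0; apply: mulr_ge0; rewrite ?sqr_ge0 ?exprn_ge0 //; last lra.
by apply: addr_ge0; rewrite ?mulr_ge0; lra.
Qed.

Lemma mix_gt0 (t u v : R) : 0 <= t <= 1 -> 0 < u -> 0 < v ->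
  0 < t * u + (1 - t) * v.
Proof.
rewrite le0r => /andP[/orP[/eqP->|t0] t1] u0 v0; first lra.
by apply: ltr_wpDr; [apply: mulr_ge0; lra|apply: mulr_gt0].
Qed.

Lemma lens_convex M s1 c1 s2 c2 t : 0 <= M -> 0 < s1 -> 0 < s2 ->
  0 <= c1 < 1 -> 0 <= c2 < 1 -> 0 <= t <= 1 ->
  lens M s1 c1 -> lens M s2 c2 ->
  lens M (t * s1 + (1 - t) * s2) (t * c1 + (1 - t) * c2).
Proof.
move=> M0 s10 s20 hc1 hc2 ht; move: (ht) => /andP[t0 t1]; rewrite /lens.
set c := t * c1 + _; set s := t * s1 + _.
have hc : 0 <= c < 1.
  case/andP: hc1 hc2 => a1 a2 /andP[d1 d2]; rewrite /c; apply/andP; split.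
    by apply: addr_ge0; apply: mulr_ge0; lra.
  by have := @mix_gt0 t (1 - c1) (1 - c2) ht; rewrite !subr_gt0 => /(_ a2 d2); lra.
have T1 := ratio_tangent hc1 hc; have T2 := ratio_tangent hc2 hc.
set D := (1 + c) / _ in T1 T2; set q := c / _ in T1 T2 *.
move: (c1 / _) (c2 / _) T1 T2 => q1 q2 T1 T2 L1 L2.
have hq : q <= t * q1 + (1 - t) * q2.
  have := lerD (ler_wpM2l t0 T1) (ler_wpM2l (_ : 0 <= 1 - t) T2).
  rewrite subr_ge0 => /(_ t1); apply: le_trans.
  by rewrite le_eqVlt; apply/orP; left; apply/eqP; rewrite /c; ring.
set h1 := c1 - M * q1 in L1; set h2 := c2 - M * q2 in L2.
have hh : t * h1 + (1 - t) * h2 <= c - M * q.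
  have := ler_wpM2l M0 hq; rewrite /h1 /h2 /c; lra.
have s0 : 0 < s by exact: mix_gt0.
have h10 : 0 <= h1.
  by rewrite -(@pmulr_rge0 _ (4 * s1)); [apply: le_trans L1; rewrite sqr_ge0|lra].
have h20 : 0 <= h2.
  by rewrite -(@pmulr_rge0 _ (4 * s2)); [apply: le_trans L2; rewrite sqr_ge0|lra].
apply: (@le_trans _ _ (4 * s * (t * h1 + (1 - t) * h2))); last first.
  by apply: ler_wpM2l => //; lra.
set p1 := s1 + c1 - 1 in L1; set p2 := s2 + c2 - 1 in L2.
have -> : s + c - 1 = t * p1 + (1 - t) * p2 by rewrite /s /c /p1 /p2; ring.
have cross : p1 * p2 <= 2 * (s1 * h2 + s2 * h1).
  have y0 : 0 <= 2 * (s1 * h2 + s2 * h1) by nra.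
  apply: le_trans (ler_norm _) _; rewrite -(@ler_pXn2r _ 2) // ?nnegrE //.
  rewrite real_normK ?num_real // exprMn.
  apply: (le_trans (ler_pM (sqr_ge0 _) (sqr_ge0 _) L1 L2)).
  by have := sqr_ge0 (s1 * h2 - s2 * h1); nra.
have u0 : 0 <= t * (1 - t) by apply: mulr_ge0; lra.
have := ler_wpM2l u0 cross; have := ler_wpM2l (sqr_ge0 t) L1.
have := ler_wpM2l (sqr_ge0 (1 - t)) L2; rewrite /s; lra.
Qed.

(** The coefficients b and c as affine functions of s = alpha lambda.  Along
    this line s = 1 + b + c is the value of z^2 + b z + c at z = 1. *)
Definition b_at beta nu s := s * (1 + nu) - (1 + beta).
Definition c_at beta nu s := beta - s * nu.

Lemma b_atE beta nu s : b_at beta nu s = s - 1 - c_at beta nu s.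
Proof. by rewrite /b_at /c_at; ring. Qed.

Lemma between_convex (x1 x x2 : R) : x1 <= x <= x2 ->
  exists2 t, 0 <= t <= 1 & x = t * x1 + (1 - t) * x2.
Proof.
move=> /andP[h1 h2]; have [e|ne] := eqVneq x1 x2.
  by exists 1; [rewrite ler01 lexx|lra].
have d : 0 < x2 - x1 by rewrite subr_gt0 lt_neqAle ne (le_trans h1 h2).
exists ((x2 - x) / (x2 - x1)); last by field; lra.
by rewrite divr_ge0 ?ler_pdivrMr //; lra.
Qed.

Lemma stable_between beta nu s1 s s2 (b := b_at beta nu) (c := c_at beta nu) :
  s1 <= s <= s2 -> stable (b s1) (c s1) -> stable (b s2) (c s2) ->
  stable (b s) (c s).
Proof.
case/between_convex => t ht ->.
move=> /stableP[a1 a2 a3 a4] /stableP[d1 d2 d3 d4].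
have e1 := mix_gt0 ht (_ : 0 < c s1 + 1) (_ : 0 < c s2 + 1).
have e2 := mix_gt0 ht (_ : 0 < 1 - c s1) (_ : 0 < 1 - c s2).
have e3 := mix_gt0 ht (_ : 0 < 1 + c s1 - b s1) (_ : 0 < 1 + c s2 - b s2).
have e4 := mix_gt0 ht (_ : 0 < 1 + c s1 + b s1) (_ : 0 < 1 + c s2 + b s2).
move: e1 e2 e3 e4; rewrite /b /c /b_at /c_at in a1 a2 a3 a4 d1 d2 d3 d4 *.
do 4 (move=> /(_ ltac:(lra) ltac:(lra)) ?).
rewrite /stable !ltr_norml; apply/andP; split; apply/andP; split; lra.
Qed.

Lemma resonant_min_gt0 b c : (0 < Num.min (4 * c - b * (1 + c)) (4 * c + b * (1 + c)))
  -> stable b c -> resonant b c.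
Proof.
rewrite lt_min => /andP[h1 h2] /stableP[c1 c2 _ _]; rewrite /resonant.
apply/andP; split; first lra.
by case: (ger0P b) => _; lra.
Qed.

(** Moving from a resonant s towards e, either e is resonant, or the segment
    leaves the resonant range at some x.  At such an x the endpoint inequality
    in the hypothesis already puts x in the lens, which avoids any convexity
    outside the resonant range. *)
Lemma exit_lens M beta nu s e (b := b_at beta nu) (c := c_at beta nu) :
  0 <= M ->
  (forall x, Num.min s e <= x <= Num.max s e ->
     [/\ 0 < x, stable (b x) (c x) & M * x <= (1 + c x - `|b x|) ^+ 2]) ->
  resonant (b s) (c s) -> M * e <= rate (b e) (c e) ^+ 2 ->
  exists2 x, Num.min s e <= x <= Num.max s e & 0 <= c x < 1 /\ lens M x (c x).
Proof.
move=> M0 H re he.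
have [|e0 ste hMe] := H e; first by rewrite ge_min le_max lexx !orbT.
have [|s0 sts hMs] := H s; first by rewrite ge_min le_max lexx.
case: (boolP (resonant (b e) (c e))) => ree.
  exists e; first by rewrite ge_min le_max lexx !orbT.
  have [c1 c2 _ _] := stableP ste; have [c0 _ _] := resonantP ree.
  split; first by lra.
  move: ree ste he; rewrite /b b_atE -/(c e) => ree ste he.
  by rewrite lens_resonant.
(* The resonant range is psi > 0; its exit point is a zero of psi. *)
pose psi x := Num.min (4 * c x - b x * (1 + c x)) (4 * c x + b x * (1 + c x)).
have psie : psi e <= 0.
  by rewrite leNgt; apply: contra ree => /resonant_min_gt0; apply.
have psis : 0 < psi s.
  by have [c0 h1 h2] := resonantP re; rewrite /psi lt_min; apply/andP; split; lra.
have cb : continuous b.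
  by move=> x; apply: cvgB; [apply: cvgM; [exact: cvg_id|exact: cvg_cst]|exact: cvg_cst].
have cc : continuous c.
  by move=> x; apply: cvgB; [exact: cvg_cst|apply: cvgM; [exact: cvg_id|exact: cvg_cst]].
have cpsi : continuous psi.
  have c4 : continuous (fun x => 4 * c x).
    by move=> x; apply: cvgM; [exact: cvg_cst|exact: cc].
  have bc : continuous (fun x => b x * (1 + c x)).
    by move=> x; apply: cvgM; [exact: cb|apply: cvgD; [exact: cvg_cst|exact: cc]].
  move=> x; apply: (@continuous_min R R (fun x => 4 * c x - b x * (1 + c x))
    (fun x => 4 * c x + b x * (1 + c x)) x).
    by apply: cvgB; [exact: c4|exact: bc].
  by apply: cvgD; [exact: c4|exact: bc].
have [x xin px] : exists2 x, x \in `[Num.min s e, Num.max s e]%R & psi x = 0.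
  apply: IVT; first by rewrite le_max !ge_min !lexx.
    exact: continuous_subspaceT.
  case: (leP s e) => _.
    by rewrite ge_min psie orbT le_max (ltW psis).
  by rewrite ge_min psie le_max (ltW psis) orbT.
exists x; first by rewrite in_itv in xin.
have [x0 stx hMx] := H x xin.
have [c1 c2 _ _] := stableP stx.
have cx : 0 <= c x /\ `|b x| * (1 + c x) = 4 * c x.
  have v0 : 0 <= 1 + c x by lra.
  move: px; rewrite /psi; case: (ger0P (b x)) => b0.
    have k := mulr_ge0 b0 v0; by rewrite minEle; case: ifP => ? ?; split; lra.
  have k := mulr_le0_ge0 (ltW b0) v0; by rewrite minEle; case: ifP => ? ?; split; lra.
case: cx => cx0 cxE.
split; first by rewrite cx0.
move: stx cxE hMx; rewrite /b b_atE -/(c x) => stx cxE hMx.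
exact: lens_boundary.
Qed.

(** Quasi-concavity of rate^2 / s along the line.  The endpoint values of the
    polynomial give the increasing function s^2 / s and, as c decreases with s,
    the decreasing function (2 (1 + c) - s)^2 / s, so that each is controlled by
    one end of the segment.  In the resonant range the lens contains a point on
    each side of s, hence s itself. *)
Theorem rate_between M beta nu s1 s s2 (b := b_at beta nu) (c := c_at beta nu) :
  0 <= nu -> 0 <= M -> 0 < s1 -> s1 <= s <= s2 ->
  stable (b s1) (c s1) -> stable (b s2) (c s2) ->
  M * s1 <= rate (b s1) (c s1) ^+ 2 -> M * s2 <= rate (b s2) (c s2) ^+ 2 ->
  M * s <= rate (b s) (c s) ^+ 2.
Proof.
move=> nu0 M0 s10 hs st1 st2 h1 h2; move: (hs) => /andP[hs1 hs2].
have stb x : s1 <= x <= s2 -> stable (b x) (c x).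
  by move=> hx; apply: stable_between hx st1 st2.
(* Endpoint inequalities on the whole segment, from s2 when b x >= 0 and
   from s1 when b x < 0. *)
have endb x : s1 <= x <= s2 -> M * x <= (1 + c x - `|b x|) ^+ 2.
  move=> /[dup] /andP[x1 x2] hx; case: (ger0P (b x)) => b0.
    have -> : 1 + c x - b x = 2 * (1 + c x) - x by rewrite /b b_atE -/(c x); ring.
    apply: (le_trans (ler_wpM2l M0 x2)).
    apply: (le_trans h2); apply: (le_trans (rate_le_endpoint st2)).
    have e2 : 1 + c s2 - b s2 = 2 * (1 + c s2) - s2 by rewrite /b b_atE -/(c s2); ring.
    have cle : c s2 <= c x by rewrite /c /c_at lerD2l lerN2 ler_wpM2r.
    have [_ _ u1 u2] := stableP st2; have n1 := ler_norm (b s2).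
    have n2 : `|b s2| < 1 + c s2 by case/andP: st2.
    rewrite ler_pXn2r // ?nnegrE; lra.
  have -> : 1 + c x - - b x = x by rewrite /b b_atE -/(c x); ring.
  have M1 : M <= s1.
    rewrite -(ler_pM2r s10); apply: (le_trans h1); apply: (le_trans (rate_le_endpoint st1)).
    have e1 : 1 + c s1 + b s1 = s1 by rewrite /b b_atE -/(c s1); ring.
    have n1 := ler_norm (- b s1); rewrite normrN in n1.
    have n2 : `|b s1| < 1 + c s1 by case/andP: st1.
    by rewrite -expr2 ler_pXn2r // ?nnegrE; lra.
  by rewrite expr2 ler_wpM2r; lra.
case: (boolP (resonant (b s) (c s))) => re; last first.
  by rewrite rate_nonresonant ?endb //; apply: stb.
have [|x1 hx1 [cx1 L1]] := @exit_lens M beta nu s s1 M0 _ re h1.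
  move=> x hx; have hx' : s1 <= x <= s2.
    by move: hx; rewrite (min_idPr hs1) (max_idPl hs1) => /andP[y1 y2]; lra.
  by split; [lra|exact: stb|exact: endb].
have [|x2 hx2 [cx2 L2]] := @exit_lens M beta nu s s2 M0 _ re h2.
  move=> x hx; have hx' : s1 <= x <= s2.
    by move: hx; rewrite (min_idPl hs2) (max_idPr hs2) => /andP[y1 y2]; lra.
  by split; [lra|exact: stb|exact: endb].
rewrite (min_idPr hs1) (max_idPl hs1) in hx1.
rewrite (min_idPl hs2) (max_idPr hs2) in hx2.
have [t ht sE] : exists2 t, 0 <= t <= 1 & s = t * x1 + (1 - t) * x2.
  by apply: between_convex; case/andP: hx1 hx2 => _ -> /andP[-> _].
have cE : c s = t * c x1 + (1 - t) * c x2 by rewrite sE /c /c_at; ring.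
have sts := stb s hs; move: re sts; rewrite /b b_atE -/(c s) => re sts.
rewrite -lens_resonant // cE sE; apply: lens_convex => //.
  by case/andP: hx1 => y1 _; apply: lt_le_trans y1.
by case/andP: hx2 => y1 _; apply: lt_le_trans y1; lra.
Qed.
End Endpoints.

(** * Series of nonnegative terms, and the response to a damped cosine *)

Section Series.
Variable R : realType.
Implicit Types u : nat -> R.

Definition nnsum u : \bar R := (\sum_(0 <= k <oo) (u k)%:E)%E.

Lemma nnsum_partial u N : (forall k, 0 <= u k) ->
  ((\sum_(k < N) u k)%:E <= nnsum u)%E.
Proof.
move=> u0; rewrite -sumEFin -(big_mkord xpredT (fun k => (u k)%:E)).
by apply: nneseries_lim_ge => k _ _; rewrite lee_fin.
Qed.

Lemma nnsum_le u C : (forall k, 0 <= u k) ->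
  (forall N, \sum_(k < N) u k <= C) -> (nnsum u <= C%:E)%E.
Proof.
move=> u0 h; apply: lime_le; first by apply: is_cvg_nneseries => k _ _; rewrite lee_fin.
by apply: nearW => N; rewrite sumEFin big_mkord lee_fin.
Qed.

Lemma nnsum_fin u C : (forall k, 0 <= u k) ->
  (forall N, \sum_(k < N) u k <= C) ->
  [/\ nnsum u = (fine (nnsum u))%:E, forall N, \sum_(k < N) u k <= fine (nnsum u)
    & fine (nnsum u) <= C].
Proof.
move=> u0 h; have hC := nnsum_le u0 h.
have fin : nnsum u \is a fin_num.
  rewrite fin_numE -ltey -ltNye (le_lt_trans hC (ltry _)) andbT.
  by apply: lt_le_trans (nnsum_partial 0 u0); rewrite big_ord0 ltNyr.
have e := fineK fin; split=> [//|N|]; first by rewrite -lee_fin e nnsum_partial.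
by rewrite -lee_fin e.
Qed.

(** A bounded nonnegative series cannot have all its late terms above e. *)
Lemma summable_small u C e n : (forall k, 0 <= u k) ->
  (forall N, \sum_(k < N) u k <= C) -> 0 < e ->
  exists2 N, (n <= N)%N & u N < e.
Proof.
move=> u0 h e0; apply: contrapT => H.
have big N : (n <= N)%N -> e <= u N.
  by move=> nN; rewrite leNgt; apply/negP => ?; apply: H; exists N.
have := h (n + (Num.truncn (C / e)).+1)%N.
rewrite big_split_ord /= leNgt => /negP; apply.
apply: (@lt_le_trans _ _ (e *+ (Num.truncn (C / e)).+1)).
  by rewrite -mulr_natr -ltr_pdivrMl // mulrC; exact: truncnS_gt.
rewrite -[leLHS]add0r lerD ?sumr_ge0 // -[in leLHS](card_ord (_.+1)) -sumr_const.
by apply: ler_sum => i _; apply: big; rewrite leq_addr.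
Qed.
End Series.

Section Response.
Variable R : realType.

(** The pair (e_k, e_(k-1)) of a mode started at rest. *)
Fixpoint response (b c : R) (v : nat -> R) (k : nat) : R * R :=
  if k is j.+1 then
    let: (e, ep) := response b c v j in (v j - b * e - c * ep, e)
  else (0, 0).

(** With C k = cos (omega k) these are the coordinates of the worst-case noise
    along its eigenvector. *)
Definition noise (t h : R) (C : nat -> R) k := Num.sqrt (h * (2 - h)) * (1 - h) ^+ k * C k.

Lemma noise_energy_le t h C N : cosine_like t C -> -1 <= t <= 1 -> 0 < h < 1 ->
  \sum_(k < N) noise t h C k ^+ 2 <= 1.
Proof.
move=> hC ht hh; apply: le_trans (geometric_energy_le h N).
rewrite mulr_sumr; apply: ler_sum => k _.
rewrite /noise !exprMn sqr_sqrtr; last by case/andP: hh => ? ?; rewrite mulr_ge0; lra.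
apply: ler_piMr; last exact: cosine_le1 hC ht.
by case/andP: hh => ? ?; rewrite mulr_ge0 ?sqr_ge0 // mulr_ge0; lra.
Qed.

(** Pairing consecutive samples bounds the energy below by a multiple of the
    normalized geometric series, half of which is collected at a finite horizon
    once (1 - h)^(2 N) < 1/2. *)
Lemma noise_energy_ge t C : cosine_like t C -> -1 <= t <= 1 ->
  exists2 k : R, 0 < k & forall h, 0 < h <= 2^-1 ->
    exists N, k <= \sum_(k < N) noise t h C k ^+ 2.
Proof.
move=> hC ht; have [m m0 hm] := cosine_pair hC ht.
exists (m / 16) => [|h /andP[h0 h1]]; first by rewrite divr_gt0.
have hh : 0 < h < 1 by apply/andP; split; lra.
have [N _ hN] : exists2 N, (0 <= N)%N & ((1 - h) ^+ N) ^+ 2 < 2^-1.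
  apply: (@summable_small _ (fun k => ((1 - h) ^+ k) ^+ 2) ((h * (2 - h))^-1)) => //.
  - by move=> k; rewrite sqr_ge0.
  - move=> N; have hp : 0 < h * (2 - h) by rewrite mulr_gt0 //; lra.
    by rewrite -(ler_pM2l hp) divff ?gt_eqF // geometric_energy_le.
exists N.+1; set S := \sum_(k < _) _.
have n2 k : noise t h C k ^+ 2 = h * (2 - h) * ((1 - h) ^+ k) ^+ 2 * C k ^+ 2.
  by rewrite /noise !exprMn sqr_sqrtr // mulr_ge0; lra.
have S1 : \sum_(k < N) noise t h C k ^+ 2 <= S.
  by rewrite /S big_ord_recr lerDl sqr_ge0.
have S2 : \sum_(k < N) noise t h C k.+1 ^+ 2 <= S.
  by rewrite /S big_ord_recl lerDr sqr_ge0.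
have : \sum_(k < N) (h * (2 - h) * ((1 - h) ^+ k) ^+ 2 * (m / 4)) <= 2 * S.
  apply: (@le_trans _ _ (\sum_(k < N) (noise t h C k ^+ 2 + noise t h C k.+1 ^+ 2))).
    apply: ler_sum => k _; rewrite !n2 [(1 - h) ^+ k.+1]exprS exprMn.
    set X := h * (2 - h) * ((1 - h) ^+ k) ^+ 2.
    have X0 : 0 <= X by rewrite mulr_ge0 ?sqr_ge0 // mulr_ge0; lra.
    have -> : h * (2 - h) * ((1 - h) ^+ 2 * ((1 - h) ^+ k) ^+ 2) * C k.+1 ^+ 2
      = X * ((1 - h) ^+ 2 * C k.+1 ^+ 2) by rewrite /X; ring.
    rewrite -mulrDr; apply: ler_wpM2l => //.
    have q : 4^-1 <= (1 - h) ^+ 2.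
      have -> : 4^-1 = 2^-1 ^+ 2 :> R by field.
      by rewrite ler_pXn2r ?nnegrE //; lra.
    have := hm k; have := ler_wpM2r (sqr_ge0 (C k.+1)) q.
    have := sqr_ge0 (C k); lra.
  by rewrite big_split /=; lra.
rewrite -mulr_suml -mulr_sumr geometric_energy => hS.
have : 2^-1 * (m / 4) <= (1 - ((1 - h) ^+ N) ^+ 2) * (m / 4).
  by apply: ler_wpM2r; [rewrite divr_ge0 ?ltW|lra].
lra.
Qed.

Variables (b c A t : R) (C : nat -> R).
Hypotheses (st : stable b c) (hC : cosine_like t C) (ht : t = peak_cos b c).

Let e h k := (response b c (fun j => A * noise t h C j) k).1.
Let r2 := rate b c ^+ 2.

Let E h k := (response b c (fun j => A * noise t h C j) k).2.
Let E1 h k : e h k = E h k.+1.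
Proof. by rewrite /e /E /=; case: (response _ _ _ k). Qed.

Let Erec h k : E h k.+2 + b * E h k.+1 + c * E h k = A * noise t h C k.
Proof.
rewrite -E1 /e /E /=; case: (response _ _ _ k) => x y /=; ring.
Qed.

Lemma response_gain h N : r2 * (\sum_(k < N) e h k ^+ 2)
  <= A ^+ 2 * \sum_(k < N) noise t h C k ^+ 2.
Proof.
have := energy_gain (E h) N st; under eq_bigr do rewrite -E1.
have -> : storage b c (E h 1) (E h 0) = 0.
  by rewrite /E /= /storage; case: ifP => _; ring.
rewrite addr0 -/r2 => /le_trans; apply; rewrite mulr_sumr le_eqVlt.
by apply/orP; left; apply/eqP; apply: eq_bigr => k _; rewrite Erec exprMn.
Qed.

(** The energy balance, where the last term bounds the final storage. *)
Lemma response_loss : exists2 K, 0 <= K & forall h, 0 < h < 1 -> forall N,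
  A ^+ 2 * (\sum_(k < N) noise t h C k ^+ 2)
   <= r2 * (\sum_(k < N) e h k ^+ 2) + K * h + 16 * (e h N ^+ 2 + E h N ^+ 2).
Proof.
move: hC Erec; rewrite ht => hC' Erec'.
have [K K0 HK] := noise_loss A st hC'; exists K => // h hh N.
have E00 : E h 0 = 0 by [].
have E01 : E h 1 = 0 by [].
have := HK (E h) h hh E00 E01; rewrite /E ht => /(_ (Erec' h) N) L.
have := energy_balance b c (E h) N; rewrite E00 E01.
have -> : storage b c 0 0 = 0 by rewrite /storage; case: ifP => _; ring.
rewrite addr0.
have -> : \sum_(k < N) (E h k.+2 + b * E h k.+1 + c * E h k) ^+ 2
   = A ^+ 2 * \sum_(k < N) noise (peak_cos b c) h C k ^+ 2.
  by rewrite mulr_sumr; apply: eq_bigr => k _; rewrite /E ht Erec' exprMn.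
move=> <-; have S := storage_le (E h N.+1) (E h N) st.
under [X in _ <= _ * X + _ + _]eq_bigr do rewrite -/(e h _) E1.
rewrite -/(e h N) E1 -/r2; rewrite /E ht in S *; lra.
Qed.
End Response.

Section Ratio.
Variable R : realType.
Variables (b c A t : R) (C : nat -> R).
Hypotheses (st : stable b c) (hC : cosine_like t C) (ht : t = peak_cos b c).

Definition noise_energy h := fine (nnsum (fun k => noise t h C k ^+ 2)).
Definition response_energy h :=
  fine (nnsum (fun k => (response b c (fun j => A * noise t h C j) k).1 ^+ 2)).

Let ht1 : -1 <= t <= 1. Proof. by rewrite ht; apply: peak_cos_bound. Qed.
Let r2 := rate b c ^+ 2.
Let r20 : 0 < r2. Proof. by rewrite exprn_gt0 ?rate_gt0. Qed.

Lemma noise_sum h : 0 < h < 1 ->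
  nnsum (fun k => noise t h C k ^+ 2) = (noise_energy h)%:E /\
  forall N, \sum_(k < N) noise t h C k ^+ 2 <= noise_energy h.
Proof.
move=> hh; have := @nnsum_fin _ (fun k => noise t h C k ^+ 2) 1.
case=> [k|N|-> h1 _]; first exact: sqr_ge0.
  exact: noise_energy_le hC ht1 hh.
by split.
Qed.

Lemma response_sum h : 0 < h < 1 ->
  [/\ nnsum (fun k => (response b c (fun j => A * noise t h C j) k).1 ^+ 2)
     = (response_energy h)%:E,
   forall N, \sum_(k < N) (response b c (fun j => A * noise t h C j) k).1 ^+ 2
      <= response_energy h
  & r2 * response_energy h <= A ^+ 2 * noise_energy h].
Proof.
move=> hh; have [_ hW] := noise_sum hh.
have := @nnsum_fin _ (fun k => (response b c (fun j => A * noise t h C j) k).1 ^+ 2)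
  (A ^+ 2 * noise_energy h / r2).
case=> [k|N|-> h1 h2]; first exact: sqr_ge0.
  rewrite ler_pdivlMr // mulrC; apply: le_trans (response_gain A t C st h N) _.
  by apply: ler_wpM2l; [exact: sqr_ge0|exact: hW].
by split=> //; rewrite mulrC -ler_pdivlMr.
Qed.

(** Letting the horizon tend to infinity in [response_loss]: the final storage
    tends to 0 along a subsequence because the response has finite energy. *)
Lemma response_energy_lower : exists2 K, 0 <= K & forall h, 0 < h < 1 ->
  A ^+ 2 * noise_energy h <= r2 * response_energy h + K * h.
Proof.
have [K K0 HK] := response_loss A st hC ht; exists K => // h hh.
have [_ hZ _] := response_sum hh; have [_ hW] := noise_sum hh.
set e := fun k => (response b c (fun j => A * noise t h C j) k).1 in hZ.
have hZ' N : \sum_(k < N) (response b c (fun j => A * noise t h C j) k).2 ^+ 2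
    <= response_energy h.
  case: N => [|N]; first by rewrite big_ord0; apply: le_trans (hZ 0%N); rewrite big_ord0.
  rewrite big_ord_recl /= expr2 mulr0 add0r; apply: le_trans (hZ N).
  by rewrite le_eqVlt; apply/orP; left; apply/eqP; apply: eq_bigr => k _ /=;
    case: (response _ _ _ k).
rewrite leNgt; apply/negP => hlt.
set dlt := A ^+ 2 * noise_energy h - (r2 * response_energy h + K * h).
have d0 : 0 < dlt by rewrite subr_gt0.
have [n hn] : exists n, A ^+ 2 * noise_energy h - dlt / 2 <=
     A ^+ 2 * \sum_(k < n) noise t h C k ^+ 2.
  have [A0|A0] := eqVneq (A ^+ 2) 0.
    by exists 0%N; rewrite A0 !mul0r; lra.
  have Ap : 0 < A ^+ 2 by rewrite lt_neqAle eq_sym A0 sqr_ge0.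
  apply: contrapT => H.
  have : noise_energy h <= noise_energy h - dlt / 2 / A ^+ 2.
    have := @nnsum_fin _ (fun k => noise t h C k ^+ 2) (noise_energy h - dlt / 2 / A ^+ 2).
    case=> [k|N|//]; first exact: sqr_ge0.
    rewrite leNgt; apply/negP => hN; apply: H; exists N.
    have := ler_wpM2l (ltW Ap) (ltW hN).
    by rewrite mulrBr (mulrCA (A ^+ 2)) divff // mulr1.
  by rewrite leNgt ltrBlDr ltrDl !divr_gt0.
have hsum N : \sum_(k < N) (e k ^+ 2 +
    (response b c (fun j => A * noise t h C j) k).2 ^+ 2)
    <= response_energy h + response_energy h by rewrite big_split; exact: lerD (hZ N) (hZ' N).
have [N nN hN] := @summable_small _
  (fun k => e k ^+ 2 + (response b c (fun j => A * noise t h C j) k).2 ^+ 2)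
  (response_energy h + response_energy h) (dlt / 32) n
  (fun k => addr_ge0 (sqr_ge0 _) (sqr_ge0 _))
  hsum ltac:(by rewrite divr_gt0).
have := HK h hh N; have := ler_wpM2l (ltW r20) (hZ N).
have : A ^+ 2 * \sum_(k < n) noise t h C k ^+ 2 <= A ^+ 2 * \sum_(k < N) noise t h C k ^+ 2.
  apply: ler_wpM2l; first exact: sqr_ge0.
  rewrite -(subnKC nN) big_split_ord /= lerDl sumr_ge0 // => i _; exact: sqr_ge0.
rewrite -/r2 -/(e _); rewrite /dlt in hn hN *.
move: (\sum_(k < N) e k ^+ 2) => S; lra.
Qed.

Lemma noise_energy_pos : exists2 k : R, 0 < k & forall h, 0 < h <= 2^-1 -> k <= noise_energy h.
Proof.
have [k k0 hk] := noise_energy_ge hC ht1; exists k => // h hh.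
have [N hN] := hk h hh; apply: le_trans hN _.
by apply: (noise_sum _).2; case/andP: hh => ? ?; apply/andP; split; lra.
Qed.

Lemma energy_ratio_cvg :
  response_energy h / noise_energy h @[h --> 0^'+] --> A ^+ 2 / r2.
Proof.
have [K K0 HK] := response_energy_lower; have [k k0 hk] := noise_energy_pos.
apply: (@squeeze_cvgr _ _ _ _ (fun h => A ^+ 2 / r2 - K / k / r2 * h) (fun=> A ^+ 2 / r2)).
- near=> h.
  have h0 : 0 < h by near: h; apply: nbhs_right_gt.
  have h1 : h <= 2^-1 by near: h; apply: nbhs_right_le; lra.
  have hh : 0 < h < 1 by apply/andP; split; lra.
  have [_ _ up] := response_sum hh; have lo := HK h hh.
  have kW := hk h; rewrite h0 h1 in kW; have {}kW := kW isT.
  have W0 : 0 < noise_energy h by apply: lt_le_trans kW.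
  apply/andP; split; last first.
    by rewrite ler_pdivrMr // mulrAC ler_pdivlMr // mulrC.
  rewrite ler_pdivlMr //.
  have e1 : K * h <= K * h / k * noise_energy h.
    have Kk : 0 <= K * h / k by rewrite divr_ge0 ?mulr_ge0 // ltW.
    by have := ler_wpM2l Kk kW; rewrite divfK // gt_eqF.
  have -> : (A ^+ 2 / r2 - K / k / r2 * h) * noise_energy h
     = (A ^+ 2 * noise_energy h - K * h / k * noise_energy h) / r2.
    by field; rewrite !gt_eqF.
  by rewrite ler_pdivrMr // mulrC; lra.
- have -> : nbhs (A ^+ 2 / r2) = nbhs (A ^+ 2 / r2 - K / k / r2 * 0).
    by rewrite mulr0 subr0.
  apply: cvgB; first exact: cvg_cst.
  apply: cvgM; first exact: cvg_cst.
  exact: cvg_at_right_filter.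
- exact: cvg_cst.
Unshelve. all: by end_near. Qed.
End Ratio.

(** * Quadratic objectives in eigencoordinates *)

Section Quadratic.
Variables (R : realType) (d : nat).
Implicit Types (Q U : 'M[R]_d) (lam : 'rV[R]_d) (p x y v : 'cV[R]_d).

Definition dot (u v : 'cV[R]_d) : R := (u^T *m v) 0 0.

Lemma dotE (u v : 'cV[R]_d) : dot u v = \sum_i u i 0 * v i 0.
Proof. by rewrite /dot mxE; apply: eq_bigr => i _; rewrite mxE. Qed.

Lemma dotC (u v : 'cV[R]_d) : dot u v = dot v u.
Proof. by rewrite !dotE; apply: eq_bigr => i _; rewrite mulrC. Qed.

Lemma dotDl (u v w : 'cV[R]_d) : dot (u + v) w = dot u w + dot v w.
Proof. by rewrite /dot linearD mulmxDl mxE. Qed.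

Lemma dotDr (u v w : 'cV[R]_d) : dot w (u + v) = dot w u + dot w v.
Proof. by rewrite /dot mulmxDr mxE. Qed.

Lemma dotZl a (u v : 'cV[R]_d) : dot (a *: u) v = a * dot u v.
Proof. by rewrite /dot linearZ -scalemxAl mxE. Qed.

Lemma dotZr a (u v : 'cV[R]_d) : dot u (a *: v) = a * dot u v.
Proof. by rewrite /dot -scalemxAr mxE. Qed.

Lemma dot_sym Q (u v : 'cV[R]_d) : Q^T = Q -> dot u (Q *m v) = dot v (Q *m u).
Proof. by move=> hQ; rewrite dotC /dot trmx_mul hQ mulmxA. Qed.

Lemma enorm_sqr (m : nat) (v : 'cV[R]_m) : enorm v ^+ 2 = \sum_i v i 0 ^+ 2.
Proof. by rewrite sqr_sqrtr // sumr_ge0 // => i _; rewrite sqr_ge0. Qed.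

Lemma quadraticE Q p r x :
  quadratic Q p r x = 2^-1 * dot x (Q *m x) + dot p x + r.
Proof. by rewrite /quadratic /dot mulmxA. Qed.

Lemma quadratic_expand Q p r x y : Q^T = Q ->
  quadratic Q p r (y + x) = quadratic Q p r x + dot y (Q *m x + p)
    + 2^-1 * dot y (Q *m y).
Proof.
move=> hQ; rewrite !quadraticE mulmxDr !dotDl !dotDr (dot_sym x y hQ) (dotC p y).
by field.
Qed.

(** The difference quotient is an affine function of the increment. *)
Lemma derive_quadratic Q p r x v : Q^T = Q ->
  'D_v (quadratic Q p r) x = dot v (Q *m x + p).
Proof.
move=> hQ; rewrite /derive; apply/cvg_lim => //.
pose g (h : R) := dot v (Q *m x + p) + h * (2^-1 * dot v (Q *m v)).
apply: (@cvg_trans _ (g h @[h --> 0^'])); last first.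
  have -> : nbhs (dot v (Q *m x + p)) = nbhs (g 0) by rewrite /g mul0r addr0.
  apply: cvg_within_filter; apply: cvgD; first exact: cvg_cst.
  by apply: cvgM; [exact: cvg_id|exact: cvg_cst].
apply: near_eq_cvg; near=> h.
have h0 : h != 0 by near: h; exact: nbhs_dnbhs_neq.
rewrite /g /= quadratic_expand // -scalemxAr !dotZl dotZr.
rewrite /GRing.scale /=; field; exact: h0.
Unshelve. all: by end_near. Qed.

Lemma grad_quadratic Q p r x : Q^T = Q -> grad (quadratic Q p r) x = Q *m x + p.
Proof.
move=> hQ; apply/colP => i; rewrite mxE derive_quadratic // dotE.
rewrite (bigD1 i) //= mxE !eqxx mul1r big1 ?addr0 // => j ji.
by rewrite mxE (negbTE ji) mul0r.
Qed.

(** Otherwise a step along minus the gradient g = Q xs + p, of the exact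
    line-search length, decreases the objective. *)
Lemma minimizer_critical Q p r xs : posdef Q ->
  (forall x, quadratic Q p r xs <= quadratic Q p r x) -> Q *m xs + p = 0.
Proof.
move=> [hQ pd] hm; apply/eqP; apply/negPn/negP => g0.
set g := _ + p in g0.
have A0 : 0 < dot g (Q *m g) by rewrite /dot mulmxA; apply: pd.
have G0 : 0 < dot g g.
  rewrite dotE; have [i gi] : exists i, g i 0 != 0.
    apply/existsP; apply: contraNT g0 => /existsPn h; apply/eqP/colP => i.
    by rewrite [RHS]mxE; apply/eqP; move: (h i); rewrite negbK.
  rewrite (bigD1 i) //= ltr_pwDl //.
    by rewrite -expr2 lt_neqAle eq_sym sqrf_eq0 gi sqr_ge0.
  by apply: sumr_ge0 => j _; rewrite -expr2 sqr_ge0.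
have := hm (- (dot g g / dot g (Q *m g)) *: g + xs).
rewrite quadratic_expand // -/g -scalemxAr !dotZl dotZr -addrA lerDl.
move: (dot g g) (dot g (Q *m g)) G0 A0 => G A G0 A0.
suff -> : - (G / A) * G + 2^-1 * (- (G / A) * (- (G / A) * A)) = - (G ^+ 2 / (2 * A)).
  by rewrite oppr_ge0 leNgt divr_gt0 ?exprn_gt0 ?mulr_gt0.
by field; rewrite gt_eqF.
Qed.

Lemma quadratic_gap Q p r xs x : Q^T = Q -> Q *m xs + p = 0 ->
  quadratic Q p r x - quadratic Q p r xs = 2^-1 * dot (x - xs) (Q *m (x - xs)).
Proof.
move=> hQ h0; rewrite -{1}(subrK xs x) quadratic_expand // h0.
by rewrite /dot mulmx0 mxE; ring.
Qed.

Lemma trmx_basis U : U^T *m U = 1%:M -> U *m U^T = 1%:M.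
Proof. exact: mulmx1C. Qed.

Lemma coord_norm U v : U^T *m U = 1%:M ->
  \sum_i (U^T *m v) i 0 ^+ 2 = \sum_i v i 0 ^+ 2.
Proof.
move=> /trmx_basis hU.
transitivity (dot (U^T *m v) (U^T *m v)).
  by rewrite dotE; apply: eq_bigr => i _; rewrite expr2.
rewrite /dot trmx_mul trmxK -mulmxA (mulmxA U) hU mul1mx -/(dot v v) dotE.
by apply: eq_bigr => i _; rewrite expr2.
Qed.

(** Q acts diagonally on the coordinates U^T v. *)
Lemma spectral_form Q U lam v : Q = U *m diag_mx lam *m U^T ->
  dot v (Q *m v) = \sum_i lam 0 i * (U^T *m v) i 0 ^+ 2.
Proof.
move=> ->; transitivity (dot (U^T *m v) (diag_mx lam *m (U^T *m v))).
  by rewrite /dot trmx_mul trmxK !mulmxA.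
rewrite dotE.
by apply: eq_bigr => i _; rewrite mul_diag_mx !mxE; ring.
Qed.

Lemma gap_coord Q U lam p r xs x : posdef Q ->
  (forall y, quadratic Q p r xs <= quadratic Q p r y) ->
  Q = U *m diag_mx lam *m U^T ->
  quadratic Q p r x - quadratic Q p r xs
    = \sum_i lam 0 i / 2 * (U^T *m (x - xs)) i 0 ^+ 2.
Proof.
move=> hQ hm hU; have h0 := minimizer_critical hQ hm.
rewrite (quadratic_gap r x hQ.1 h0) (spectral_form _ hU) mulr_sumr.
by apply: eq_bigr => i _; ring.
Qed.

Lemma coord_eigen Q U lam v : U^T *m U = 1%:M ->
  Q = U *m diag_mx lam *m U^T -> forall i,
  (U^T *m (Q *m v)) i 0 = lam 0 i * (U^T *m v) i 0.
Proof.
move=> hU -> i; rewrite -!mulmxA (mulmxA U^T) hU mul1mx.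
by rewrite mul_diag_mx mxE.
Qed.

Lemma eigenvalue_coord Q U lam i : U^T *m U = 1%:M ->
  Q = U *m diag_mx lam *m U^T -> eigenvalue Q (lam 0 i).
Proof.
move=> hU hQ; apply/eigenvalueP; exists (row i U^T).
  rewrite hQ -row_mul !mulmxA hU mul1mx.
  by apply/rowP => j; rewrite mul_diag_mx !mxE.
apply/eqP => /(congr1 (fun m => m *m U)).
rewrite -row_mul hU mul0mx => /matrixP /(_ 0 i).
by rewrite !mxE eqxx => /eqP; rewrite oner_eq0.
Qed.

Lemma eigen_index Q U lam a : U^T *m U = 1%:M ->
  Q = U *m diag_mx lam *m U^T -> eigenvalue Q a -> exists i, lam 0 i = a.
Proof.
move=> hU hQ /eigenvalueP[v hv v0].
have : v *m U != 0.
  apply: contraNneq v0 => /(congr1 (fun m => m *m U^T)).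
  by rewrite -mulmxA trmx_basis // mulmx1 mul0mx => ->.
move=> h; have [j vj] : exists j, (v *m U) 0 j != 0.
  apply/existsP; apply: contraNT h => /existsPn h; apply/eqP/rowP => j.
  by rewrite [RHS]mxE; apply/eqP; move: (h j); rewrite negbK.
exists j; apply: (mulfI vj).
have : (v *m Q) *m U = (v *m U) *m diag_mx lam.
  by rewrite hQ !mulmxA -[X in X = _]mulmxA hU mulmx1.
rewrite hv -scalemxAl mul_mx_diag => /rowP /(_ j) e.
by move: e; rewrite [in LHS]mxE [in RHS]mxE (mulrC a) => ->.
Qed.
End Quadratic.

(** * Stability of the eigenmodes *)

Import ComplexField.Normc.

Section Stability.
Local Open Scope complex_scope.
Variable R : realType.

Lemma normc_real (x : R) : normc x%:C = `|x|.
Proof. by rewrite /normc /= expr0n addr0 sqrtr_sqr. Qed.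

Lemma normc_ge0 (z : R[i]) : 0 <= normc z.
Proof. by case: z => a b; rewrite sqrtr_ge0. Qed.

(** The product of the two complex roots is c.  If |b| >= 1 + c, the
    discriminant is nonnegative and a real root has modulus at least 1. *)
Lemma jury_criterion (b c : R) :
  (forall z : R[i], z ^+ 2 + b%:C * z + c%:C = 0 -> normc z < 1) -> stable b c.
Proof.
move=> H.
have Hr (x : R) : x ^+ 2 + b * x + c = 0 -> `|x| < 1.
  move=> hx; rewrite -normc_real; apply: H.
  by rewrite -rmorphXn -rmorphM -!rmorphD /= hx.
have c1 : `|c| < 1.
  pose s : R[i] := sqrtc ((b ^+ 2 - 4 * c)%:C).
  have s2 : s ^+ 2 = b%:C ^+ 2 - 4 * c%:C.
    by rewrite sqr_sqrtc rmorphB rmorphXn rmorphM /= rmorph_nat.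
  pose z1 := (- b%:C + s) / 2; pose z2 := (- b%:C - s) / 2.
  have cE : z1 * z2 = c%:C.
    transitivity ((b%:C ^+ 2 - s ^+ 2) / 4); first by rewrite /z1 /z2; field.
    by rewrite s2; field.
  have h1 : normc z1 < 1.
    apply: H; transitivity ((s ^+ 2 - b%:C ^+ 2 + 4 * c%:C) / 4).
      by rewrite /z1; field.
    by rewrite s2; field.
  have h2 : normc z2 < 1.
    apply: H; transitivity ((s ^+ 2 - b%:C ^+ 2 + 4 * c%:C) / 4).
      by rewrite /z2; field.
    by rewrite s2; field.
  rewrite -normc_real -cE normcM.
  apply: le_lt_trans (_ : _ <= normc z1) h1.
  by rewrite ler_piMr ?normc_ge0 // ltW.
rewrite /stable c1 /=; move: c1; rewrite !ltr_norml => /andP[c1 c2].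
have root e : e ^+ 2 = 1 -> 0 < 1 + c - e * b.
  move=> e2; rewrite ltNge; apply/negP => h.
  have D : (2 - e * b) ^+ 2 <= b ^+ 2 - 4 * c.
    have -> : (2 - e * b) ^+ 2 = 4 - 4 * e * b + e ^+ 2 * b ^+ 2 by ring.
    by rewrite e2; lra.
  have D0 : 0 <= b ^+ 2 - 4 * c by apply: le_trans (sqr_ge0 _) D.
  have s2 : Num.sqrt (b ^+ 2 - 4 * c) ^+ 2 = b ^+ 2 - 4 * c by rewrite sqr_sqrtr.
  have sge : 2 - e * b <= Num.sqrt (b ^+ 2 - 4 * c).
    apply: le_trans (ler_norm _) _.
    by rewrite -sqrtr_sqr ler_sqrt.
  move: (Num.sqrt _) s2 sge => s s2 sge.
  have hx : `|(- b - e * s) / 2| < 1.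
    apply: Hr; transitivity ((e ^+ 2 * s ^+ 2 - b ^+ 2) / 4 + c); first by field.
    by rewrite e2 s2; field.
  have : `|e * ((- b - e * s) / 2)| < 1.
    rewrite normrM; have -> : `|e| = 1.
      by apply/eqP; rewrite -sqrp_eq1 // real_normK ?num_real // e2.
    by rewrite mul1r.
  have -> : e * ((- b - e * s) / 2) = (- (e * b) - e ^+ 2 * s) / 2 by field.
  by rewrite e2 mul1r ltr_norml => /andP[? _]; lra.
have := root 1 (expr1n _ _); have := root (-1); rewrite sqrrN expr1n => /(_ erefl).
by move=> ? ?; apply/andP; split; lra.
Qed.

(** The supremum in the definition is that of a bounded set, since the
    eigenvalues are the roots of the characteristic polynomial. *)
Lemma eigenvalue_spectral_radius n (M : 'M[R]_n) (a : R[i]) :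
  eigenvalue (complex_mx M) a -> normc a <= spectral_radius M.
Proof.
move=> ha; rewrite /spectral_radius; apply: ub_le_sup; last by exists a.
have [rs hrs] := closed_field_poly_normal (char_poly (complex_mx M)).
exists (\sum_(x <- rs) normc x) => _ [x hx <-].
have xrs : x \in rs.
  move: hx; rewrite /= eigenvalue_root_char hrs (monicP (char_poly_monic _)).
  by rewrite scale1r root_prod_XsubC.
by rewrite (big_rem _ xrs) /= lerDl sumr_ge0 // => y _; apply: normc_ge0.
Qed.

Variable d : nat.
Implicit Types (Q U : 'M[R]_d) (lam : 'rV[R]_d).

(** For a left eigenvector q of Q, the row (q, (z + b) q) is a left eigenvector
    of A_Q. *)
Lemma AQ_eigenvalue alpha beta nu Q l (z : R[i]) (b := b_ alpha beta nu l)
    (c := c_ alpha beta nu l) : Q^T = Q ->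
  eigenvalue Q l -> z ^+ 2 + b%:C * z + c%:C = 0 ->
  eigenvalue (complex_mx (AQ alpha beta nu Q)) z.
Proof.
move=> hQ /eigenvalueP[q hq q0] hz; apply/eigenvalueP.
pose qc := complex_mx q.
have hqc : qc *m complex_mx Q = l%:C *: qc.
  by rewrite /qc /complex_mx -map_mxM hq map_mxZ.
exists (row_mx qc ((z + b%:C) *: qc)); last first.
  apply: contraNneq q0 => /(congr1 lsubmx); rewrite row_mxKl linear0 => h.
  apply/eqP/(@map_mx_inj _ _ (real_complex R)).
  by rewrite map_mx0.
have eP : qc *m complex_mx ((1 + beta)%:M - (alpha * (1 + nu)) *: Q) = (- b%:C) *: qc.
  rewrite /complex_mx map_mxB map_scalar_mx map_mxZ mulmxBr mul_mx_scalar.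
  rewrite -scalemxAr hqc scalerA -scalerBl; congr (_ *: _).
  by rewrite /b /b_ !(rmorphB, rmorphM, rmorphD) /=; ring.
have eR : qc *m complex_mx (- beta%:M + (alpha * nu) *: Q) = (- c%:C) *: qc.
  rewrite /complex_mx map_mxD map_mxN map_scalar_mx map_mxZ mulmxDr mulmxN mul_mx_scalar.
  rewrite -scalemxAr hqc scalerA -scaleNr -scalerDl; congr (_ *: _).
  by rewrite /c /c_ !(rmorphB, rmorphM, rmorphD) /=; ring.
rewrite /AQ /complex_mx map_block_mx mul_row_block -!/(complex_mx _) eP eR.
rewrite /complex_mx map_mx1 map_mx0 mulmx1 mulmx0 addr0 scale_row_mx.
rewrite -scalerDl; congr (row_mx (_ *: _) _); first by ring.
rewrite scalerA; congr (_ *: _).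
by apply/eqP; rewrite -subr_eq0 -oppr_eq0; apply/eqP; rewrite -hz; ring.
Qed.

Lemma stable_mode alpha beta nu Q l : Q^T = Q ->
  spectral_radius (AQ alpha beta nu Q) < 1 -> eigenvalue Q l ->
  stable (b_ alpha beta nu l) (c_ alpha beta nu l).
Proof.
move=> hQ hr hl; apply: jury_criterion => z hz; apply: le_lt_trans hr.
exact/eigenvalue_spectral_radius/AQ_eigenvalue/hz.
Qed.
End Stability.

(** * The transfer matrix on the unit circle *)

Section Transfer.
Local Open Scope complex_scope.
Variable R : realType.

Lemma normc_sqr (z : R[i]) : normc z ^+ 2 = complex.Re z ^+ 2 + complex.Im z ^+ 2.
Proof. by case: z => a b; rewrite sqr_sqrtr // addr_ge0 ?sqr_ge0. Qed.

Lemma norm1_normc (z : R[i]) : `|z| = 1 -> normc z = 1.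
Proof. by move=> h; apply: complexI; rewrite -[LHS]/(`|z|) h. Qed.

Definition mode_poly (b c : R) (z : R[i]) : R[i] := z ^+ 2 + b%:C * z + c%:C.

Lemma normc_mode_poly b c z : normc z = 1 ->
  normc (mode_poly b c z) ^+ 2 = circle_gain b c (complex.Re z).
Proof.
move=> z1; have := normc_sqr z; rewrite z1 expr1n => e.
rewrite normc_sqr /mode_poly; case: z {z1} e => x y /= e; rewrite /circle_gain.
rewrite expr2 /=; simpc => /=.
have y2 : y ^+ 2 = 1 - x ^+ 2 by rewrite e; ring.
by ring: y2.
Qed.

Variable d : nat.
Implicit Types (Q U : 'M[R]_d) (lam : 'rV[R]_d).

(** Matrices that are diagonal in the basis given by the columns of V.  All the
    blocks of A_Q and of its resolvent are of this form, which reduces their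
    algebra to that of their diagonals. *)
Definition conj_diag (V : 'M[R[i]]_d) (x : 'I_d -> R[i]) := V *m diag_mx (\row_i x i) *m V^T.

Lemma conj_diagD V x y : conj_diag V x + conj_diag V y = conj_diag V (fun i => x i + y i).
Proof.
rewrite /conj_diag -mulmxDl -mulmxDr -linearD; congr (_ *m diag_mx _ *m _).
by apply/rowP => i; rewrite !mxE.
Qed.

Lemma conj_diagZ V a x : a *: conj_diag V x = conj_diag V (fun i => a * x i).
Proof.
rewrite /conj_diag scalemxAl scalemxAr -linearZ; congr (_ *m diag_mx _ *m _).
by apply/rowP => i; rewrite !mxE.
Qed.

Lemma conj_diagN V x : - conj_diag V x = conj_diag V (fun i => - x i).
Proof.
by rewrite -scaleN1r conj_diagZ; congr conj_diag; apply/funext => i; rewrite mulN1r.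
Qed.

Lemma conj_diagM V x y : V^T *m V = 1%:M ->
  conj_diag V x *m conj_diag V y = conj_diag V (fun i => x i * y i).
Proof.
move=> hV; rewrite /conj_diag -!mulmxA (mulmxA V^T) hV mul1mx (mulmxA (diag_mx _)).
rewrite mulmx_diag; congr (_ *m (diag_mx _ *m _)).
by apply/rowP => i; rewrite !mxE.
Qed.

Lemma conj_diag_scalar V a : V^T *m V = 1%:M -> conj_diag V (fun=> a) = a%:M.
Proof.
move=> hV; rewrite /conj_diag (_ : diag_mx _ = a%:M); last first.
  by rewrite -diag_const_mx; congr diag_mx; apply/rowP => i; rewrite !mxE.
by rewrite mul_mx_scalar -scalemxAl (mulmx1C hV) scalemx1.
Qed.

Lemma complex_mx_orth U : U^T *m U = 1%:M ->
  (complex_mx U)^T *m complex_mx U = 1%:M.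
Proof. by move=> h; rewrite /complex_mx matrix.map_trmx -map_mxM h map_mx1. Qed.

(** A real orthogonal matrix acts separately on real and imaginary parts. *)
Lemma complex_coord_norm U (v : 'cV[R[i]]_d) : U^T *m U = 1%:M ->
  \sum_i normc (((complex_mx U)^T *m v) i 0) ^+ 2 = \sum_i normc (v i 0) ^+ 2.
Proof.
move=> hU.
have hRe i : complex.Re (((complex_mx U)^T *m v) i 0) = (U^T *m map_mx (@complex.Re R) v) i 0.
  rewrite !mxE (raddf_sum (@complex.Re R : Rcomplex R -> R)); apply: eq_bigr => j _.
  by rewrite !mxE; case: (v j 0) => x y /=; rewrite mul0r subr0.
have hIm i : complex.Im (((complex_mx U)^T *m v) i 0) = (U^T *m map_mx (@complex.Im R) v) i 0.
  rewrite !mxE (raddf_sum (@complex.Im R : Rcomplex R -> R)); apply: eq_bigr => j _.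
  by rewrite !mxE; case: (v j 0) => x y /=; rewrite mul0r addr0.
under eq_bigr do rewrite normc_sqr hRe hIm.
rewrite big_split /= !coord_norm // -big_split /=.
by apply: eq_bigr => i _; rewrite normc_sqr !mxE.
Qed.

Section Formula.
Variables (alpha beta nu : R) (Q U : 'M[R]_d) (lam : 'rV[R]_d).
Hypotheses (hUU : U^T *m U = 1%:M) (hQU : Q = U *m diag_mx lam *m U^T).
Let V := complex_mx U.
Let bi i := b_ alpha beta nu (lam 0 i).
Let ci i := c_ alpha beta nu (lam 0 i).

Lemma complex_conj_diag : complex_mx Q = conj_diag V (fun i => (lam 0 i)%:C).
Proof.
rewrite hQU /complex_mx !map_mxM map_diag_mx -matrix.map_trmx /conj_diag.
by congr (_ *m diag_mx _ *m _); apply/rowP => i; rewrite !mxE.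
Qed.

(** The first block column of (z - A_Q)^-1, times - alpha: the second block
    row of z - A_Q forces the shape (z K, K), and the first one then reads
    (z^2 + b z + c) K = - alpha on each eigenvector. *)
Lemma resolvent_column z : (forall i, mode_poly (bi i) (ci i) z != 0) ->
  let K := conj_diag V (fun i => - alpha%:C / mode_poly (bi i) (ci i) z) in
  (z%:M - complex_mx (AQ alpha beta nu Q)) *m col_mx (z *: K) K
    = complex_mx (Bmx d alpha).
Proof.
move=> hD K; have hV : V^T *m V = 1%:M := complex_mx_orth hUU.
have eP : complex_mx ((1 + beta)%:M - (alpha * (1 + nu)) *: Q)
    = conj_diag V (fun i => - (bi i)%:C).
  rewrite /complex_mx map_mxB map_scalar_mx map_mxZ -/(complex_mx Q) complex_conj_diag.
  rewrite -(conj_diag_scalar _ hV) -scaleNr conj_diagZ conj_diagD.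
  congr conj_diag; apply/funext => i.
  by rewrite /bi /b_ !(rmorphB, rmorphM, rmorphD) /=; ring.
have eR : complex_mx (- beta%:M + (alpha * nu) *: Q) = conj_diag V (fun i => - (ci i)%:C).
  rewrite /complex_mx map_mxD map_mxN map_scalar_mx map_mxZ -/(complex_mx Q) complex_conj_diag.
  rewrite -(conj_diag_scalar _ hV) conj_diagN conj_diagZ conj_diagD.
  congr conj_diag; apply/funext => i.
  by rewrite /ci /c_ !(rmorphB, rmorphM, rmorphD) /=; ring.
rewrite /AQ /complex_mx map_block_mx -!/(complex_mx _) eP eR.
rewrite /complex_mx map_mx1 map_mx0 scalar_mx_block opp_block_mx add_block_mx.
rewrite mul_block_col /Bmx map_col_mx map_mxN map_scalar_mx map_mx0.
congr col_mx; last by rewrite !sub0r subr0 mulNmx mul1mx mul_scalar_mx addNr.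
rewrite sub0r -!(conj_diag_scalar _ hV).
rewrite !conj_diagN conj_diagD /K conj_diagZ !conj_diagM // conj_diagD.
congr conj_diag; apply/funext => i; rewrite -[RHS]mulr1 -(divff (hD i)) /mode_poly; field.
exact: hD.
Qed.

Lemma transferE z : normc z = 1 ->
  spectral_radius (AQ alpha beta nu Q) < 1 ->
  (forall i, mode_poly (bi i) (ci i) z != 0) ->
  forall v, cenorm (transfer alpha beta nu Q U lam z *m v) ^+ 2
   = \sum_i alpha ^+ 2 * (Num.sqrt (lam 0 i)) ^+ 2 / 2 / circle_gain (bi i) (ci i) (complex.Re z)
       * normc ((V^T *m v) i 0) ^+ 2.
Proof.
move=> z1 hr hD v; have hV : V^T *m V = 1%:M := complex_mx_orth hUU.
have unit : z%:M - complex_mx (AQ alpha beta nu Q) \in unitmx.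
  rewrite -row_free_unit; apply/negPn/negP => h.
  suff /eigenvalue_spectral_radius : eigenvalue (complex_mx (AQ alpha beta nu Q)) z.
    by rewrite z1 leNgt hr.
  by rewrite /eigenvalue /eigenspace kermx_eq0 /row_free -opprB mxrank_opp.
rewrite /cenorm sqr_sqrtr; last by apply: sumr_ge0 => i _; rewrite sqr_ge0.
apply: eq_bigr => i _.
rewrite /transfer -(resolvent_column hD) -(mulmxA (complex_mx (Tmx _ _))) (mulKmx unit).
rewrite /Tmx /complex_mx map_row_mx map_mx0 mul_row_col mul0mx addr0.
set K := conj_diag V _.
have -> : map_mx (real_complex R) ((Num.sqrt 2)^-1 *: (diag_mx (map_mx Num.sqrt lam) *m U^T))
    *m (z *: K) *m v
  = ((Num.sqrt 2)^-1%:C * z) *: (diag_mx (\row_i ((Num.sqrt (lam 0 i))%:C *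
       (- alpha%:C / mode_poly (bi i) (ci i) z))) *m (V^T *m v)).
  rewrite map_mxZ map_mxM map_diag_mx -matrix.map_trmx -/(complex_mx U) -/V.
  rewrite -!scalemxAl -scalemxAr -scalemxAl scalerA; congr (_ *: _).
  rewrite /K /conj_diag !mulmxA -(mulmxA _ V^T V) hV mulmx1 mulmx_diag.
  congr (_ *m _ *m _); congr diag_mx; apply/rowP => j; rewrite !mxE.
  by [].
rewrite mxE mul_diag_mx mxE mxE !normcM z1 mulr1 !normc_real !exprMn.
rewrite normcV normcN normc_real -/(normc _) exprVn normc_mode_poly // !real_normK ?num_real //.
rewrite exprVn (sqr_sqrtr (ler0n R 2)).
by move: (_ ^+ 2) (circle_gain _ _ _)^-1 (normc _ ^+ 2) => s g n; field.
Qed.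
End Formula.
End Transfer.

Section SpectralNorm.
Local Open Scope complex_scope.
Variables (R : realType) (d : nat) (U : 'M[R]_d) (M : 'M[R[i]]_d) (g : 'I_d -> R).
Hypothesis hU : U^T *m U = 1%:M.
Hypothesis hM : forall v, cenorm (M *m v) ^+ 2
  = \sum_i g i * normc (((complex_mx U)^T *m v) i 0) ^+ 2.

Lemma cenorm_ge0 n (v : 'cV[R[i]]_n) : 0 <= cenorm v.
Proof. exact: sqrtr_ge0. Qed.

Lemma cenorm_sqr n (v : 'cV[R[i]]_n) :
  cenorm v ^+ 2 = \sum_i normc (v i 0) ^+ 2.
Proof. by rewrite sqr_sqrtr // sumr_ge0 // => i _; rewrite sqr_ge0. Qed.

Lemma cenorm_le G (v : 'cV[R[i]]_d) : 0 <= G -> (forall i, g i <= G ^+ 2) ->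
  cenorm v = 1 -> cenorm (M *m v) <= G.
Proof.
move=> G0 hg v1; rewrite -(@ler_pXn2r _ 2) ?nnegrE ?cenorm_ge0 // hM.
apply: (@le_trans _ _ (\sum_i G ^+ 2 * normc (((complex_mx U)^T *m v) i 0) ^+ 2)).
  by apply: ler_sum => i _; rewrite ler_wpM2r ?sqr_ge0.
by rewrite -mulr_sumr complex_coord_norm // -cenorm_sqr v1 expr1n mulr1.
Qed.

(** The squared norm of the image is a weighted sum of squared coordinates, so
    each weight is reached on a basis vector. *)
Lemma spectral_norm_bounds G i : 0 <= G -> (forall i, g i <= G ^+ 2) ->
  Num.sqrt (g i) <= spectral_norm M <= G.
Proof.
move=> G0 hg.
pose v : 'cV[R[i]]_d := complex_mx U *m delta_mx i 0.
have hv j : ((complex_mx U)^T *m v) j 0 = (j == i)%:R.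
  by rewrite /v mulmxA complex_mx_orth // mul1mx mxE eqxx andbT.
have v1 : cenorm v = 1.
  apply/eqP; rewrite -sqrp_eq1 ?cenorm_ge0 //; apply/eqP.
  rewrite cenorm_sqr -(complex_coord_norm _ hU) (bigD1 i) //= big1 ?addr0.
    by rewrite hv eqxx normc1 expr1n.
  by move=> j ji; rewrite hv (negbTE ji) normc0 expr0n.
have Mv : cenorm (M *m v) = Num.sqrt (g i).
  have e : cenorm (M *m v) ^+ 2 = g i.
    rewrite hM (bigD1 i) //= big1 ?addr0.
      by rewrite hv eqxx normc1 expr1n mulr1.
    by move=> j ji; rewrite hv (negbTE ji) normc0 expr0n /= mulr0.
  by rewrite -e sqrtr_sqr ger0_norm ?cenorm_ge0.
apply/andP; split; last first.
  apply: ge_sup; first by exists (cenorm (M *m v)); exists v.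
  by move=> _ [w /= w1 <-]; apply: cenorm_le.
rewrite -Mv; apply: ub_le_sup; last by exists v.
by exists G => _ [w /= w1 <-]; apply: cenorm_le.
Qed.
End SpectralNorm.

Section Hinf.
Local Open Scope complex_scope.
Variables (R : realType) (d : nat).
Variables (alpha beta nu : R) (Q U : 'M[R]_d) (lam : 'rV[R]_d).
Hypotheses (hUU : U^T *m U = 1%:M) (hQU : Q = U *m diag_mx lam *m U^T).
Hypothesis hr : spectral_radius (AQ alpha beta nu Q) < 1.
Hypothesis lam_gt0 : forall i, 0 < lam 0 i.
Let bi i := b_ alpha beta nu (lam 0 i).
Let ci i := c_ alpha beta nu (lam 0 i).

(** The square of the largest modulus on the unit circle of the transfer
    function of mode i. *)
Definition mode_gain i := alpha ^+ 2 * lam 0 i / 2 / rate (bi i) (ci i) ^+ 2.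

Lemma Q_sym : Q^T = Q.
Proof. by rewrite hQU !trmx_mul trmxK tr_diag_mx mulmxA. Qed.

Lemma modes_stable i : stable (bi i) (ci i).
Proof.
apply: (@stable_mode _ _ _ _ _ Q) => //; first exact: Q_sym.
exact: eigenvalue_coord hUU hQU.
Qed.

(** The supremum is reached at the point of the circle above the extremal
    cosine of the mode i0. *)
Lemma Hinf_max G i0 : 0 <= G -> (forall i, mode_gain i <= G ^+ 2) ->
  mode_gain i0 = G ^+ 2 ->
  Hinf alpha beta nu Q U lam = G /\
  exists2 zeta : R[i], `|zeta| = 1
    & spectral_norm (transfer alpha beta nu Q U lam zeta) = G.
Proof.
move=> G0 hg hi0.
pose g (z : R[i]) i := alpha ^+ 2 * (Num.sqrt (lam 0 i)) ^+ 2 / 2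
  / circle_gain (bi i) (ci i) (complex.Re z).
have re1 (z : R[i]) : normc z = 1 -> -1 <= complex.Re z <= 1.
  move=> z1; have := normc_sqr z; rewrite z1 expr1n => e.
  have := sqr_ge0 (complex.Im z); rewrite -ler_norml -(@expr_le1 _ 2) //.
  by rewrite real_normK ?num_real //; lra.
have hgz (z : R[i]) : normc z = 1 -> forall i, g z i <= G ^+ 2.
  move=> z1 i; apply: le_trans (hg i); rewrite /g /mode_gain sqr_sqrtr ?(ltW (lam_gt0 _)) //.
  have st := modes_stable i; have r0 := rate_gt0 st.
  have := circle_gain_ge st (re1 z z1).
  have r20 : 0 < rate (bi i) (ci i) ^+ 2 by rewrite exprn_gt0.
  move=> h; apply: ler_wpM2l.
    by rewrite divr_ge0 // mulr_ge0 ?sqr_ge0 ?ltW.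
  by rewrite lef_pV2 ?posrE // (lt_le_trans r20).
have hD (z : R[i]) : normc z = 1 -> forall i, mode_poly (bi i) (ci i) z != 0.
  move=> z1 i; apply/negP => /eqP h; have := normc_mode_poly (bi i) (ci i) z1.
  rewrite h normc0 expr0n /= => e.
  have st := modes_stable i; have := circle_gain_ge st (re1 z z1).
  by rewrite -e leNgt exprn_gt0 // rate_gt0.
have key (z : R[i]) : normc z = 1 -> forall i,
    Num.sqrt (g z i) <= spectral_norm (transfer alpha beta nu Q U lam z) <= G.
  move=> z1 i; apply: (@spectral_norm_bounds _ _ U _ (g z)) => //; last exact: hgz.
  by move=> v; exact: (transferE hUU hQU z1 hr (hD z z1) v).
pose t := peak_cos (bi i0) (ci i0); have st := modes_stable i0.
have /andP[t1 t2] : -1 <= t <= 1 := peak_cos_bound st.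
pose zeta : R[i] := t +i* Num.sqrt (1 - t ^+ 2).
have t20 : 0 <= 1 - t ^+ 2.
  rewrite subr_ge0 -[leRHS](expr1n _ 2) -subr_ge0 subr_sqr.
  by apply: mulr_ge0; lra.
have z1 : normc zeta = 1.
  by rewrite /normc /= sqr_sqrtr // addrC subrK sqrtr1.
have zG : spectral_norm (transfer alpha beta nu Q U lam zeta) = G.
  apply/eqP; rewrite eq_le; have /andP[h1 ->] := key _ z1 i0 => /=.
  apply: le_trans h1; rewrite /g /= circle_gain_peak // sqr_sqrtr ?(ltW (lam_gt0 _)) //.
  by rewrite -/(mode_gain i0) hi0 sqrtr_sqr ger0_norm.
have zN : `|zeta| = 1 by rewrite -[LHS]/((normc zeta)%:C) z1.
split; last by exists zeta.
apply/eqP; rewrite eq_le; apply/andP; split.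
  apply: ge_sup; first by exists G, zeta.
  by move=> _ [z /= /norm1_normc z1' <-]; case/andP: (key z z1' i0).
rewrite -{1}zG; apply: ub_le_sup; last by exists zeta.
by exists G => _ [z /= /norm1_normc z1' <-]; case/andP: (key z z1' i0).
Qed.
End Hinf.

(** * Momentum iterates in eigencoordinates *)

Section Bridge.
Variable R : realType.
Implicit Types alpha beta nu l : R.

Lemma r_rate alpha beta nu l :
  r_ alpha beta nu l = rate (b_ alpha beta nu l) (c_ alpha beta nu l).
Proof.
rewrite /r_ /rate; move: (b_ _ _ _ _) (c_ _ _ _ _) => b c.
congr (if _ then _ else _); rewrite /resonant; case: ltrP => //= c0.
by rewrite ltr_pdivrMr ?mul1r //; lra.
Qed.

(** The case distinctions of [omega] and [peak_cos] agree: for 1 + c > 0 the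
    comparison of the squares is the sign of b. *)
Lemma cos_omega alpha beta nu l (b := b_ alpha beta nu l) (c := c_ alpha beta nu l) :
  stable b c -> cos (omega alpha beta nu l) = peak_cos b c.
Proof.
move=> st; have := peak_cos_bound st; rewrite /omega /peak_cos -/b -/c.
clearbody b c.
have [c1 c2 b1 b2] := stableP st.
have -> : (0 < c) && (`|b * (1 + c)| < 4 * `|c|) = resonant b c.
  rewrite /resonant; case: ltrP => //= c0.
  by rewrite normrM (gtr0_norm c0) (@gtr0_norm _ (1 + c)) //; lra.
case: ifPn => re; first by move=> ht; rewrite acosK // in_itv.
have -> : ((1 - b + c) ^+ 2 <= (1 + b + c) ^+ 2) = (0 <= b).
  rewrite -subr_ge0 (_ : _ - _ = (4 * (1 + c)) * b); last by ring.
  by rewrite pmulr_rge0 // mulr_gt0 //; lra.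
have [b0|b0] := lerP 0 b; last by rewrite !andbF cos0.
rewrite !andbT => _; case: lerP => c0; first by rewrite cospi.
rewrite (_ : 4 * `|c| <= _); first by rewrite cospi.
move: re; rewrite /resonant c0 /= -leNgt normrM (gtr0_norm c0).
by rewrite (@gtr0_norm _ (1 + c)) //; lra.
Qed.

Lemma cosine_like_cos (om : R) : cosine_like (cos om) (fun k => cos (om * k%:R)).
Proof.
split=> [||k]; rewrite ?mulr0 ?cos0 ?mulr1 //.
have -> : om * k.+2%:R = om * k.+1%:R + om by rewrite -(natr1 k.+1) mulrDr mulr1.
have -> : om * k%:R = om * k.+1%:R - om by rewrite -(natr1 k) mulrDr mulr1 addrK.
by rewrite cosB cosD; ring.
Qed.
End Bridge.

Section GMM.
Variables (R : realType) (d : nat) (Q : 'M[R]_d) (p : 'cV[R]_d) (r : R).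
Variables (xs : 'cV[R]_d) (alpha beta nu : R).
Hypothesis hQ : posdef Q.
Hypothesis hxs : forall x, quadratic Q p r xs <= quadratic Q p r x.
Let f := quadratic Q p r.

Lemma grad_gap x : grad f x = Q *m (x - xs).
Proof.
rewrite grad_quadratic; last exact: hQ.1.
have h0 := minimizer_critical hQ hxs.
by rewrite mulmxBr -[RHS]addr0 -h0 addrA subrK.
Qed.

Lemma state_shift w x0 k :
  (gmm_state f alpha beta nu w x0 k.+1).2 = gmm f alpha beta nu w x0 k.
Proof. by rewrite /gmm /=; case: (gmm_state _ _ _ _ _ _ _). Qed.

Variables (U : 'M[R]_d) (lam : 'rV[R]_d).
Hypotheses (hUU : U^T *m U = 1%:M) (hQU : Q = U *m diag_mx lam *m U^T).
Let bi i := b_ alpha beta nu (lam 0 i).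
Let ci i := c_ alpha beta nu (lam 0 i).

(** The i-th eigencoordinate of x_(k-1) - xs.  Indexing by the previous iterate
    makes the doubled initial value x_0 = x_(-1) the first two terms of the
    sequence. *)
Definition prev_coord w x0 i k : R :=
  (U^T *m ((gmm_state f alpha beta nu w x0 k).2 - xs)) i 0.

Lemma prev_coord_rec w x0 i k :
  prev_coord w x0 i k.+2 + bi i * prev_coord w x0 i k.+1 + ci i * prev_coord w x0 i k
    = - alpha * (U^T *m w k) i 0.
Proof.
rewrite /prev_coord /=; case: (gmm_state _ _ _ _ _ _ _) => x xp /=.
pose cf (v : 'cV[R]_d) := (U^T *m v) i 0; rewrite -!/(cf _).
have cD v v' : cf (v + v') = cf v + cf v' by rewrite /cf mulmxDr mxE.
have cZ a v : cf (a *: v) = a * cf v by rewrite /cf -scalemxAr mxE.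
have cN v : cf (- v) = - cf v by rewrite -scaleN1r cZ mulN1r.
have cQ v : cf (Q *m v) = lam 0 i * cf v by exact: coord_eigen hUU hQU i.
by rewrite grad_gap !(cN, cD, cZ, cQ) /bi /ci /b_ /c_; ring.
Qed.

Lemma gap_prev_coord w x0 k : f (gmm f alpha beta nu w x0 k) - f xs
  = \sum_i lam 0 i / 2 * prev_coord w x0 i k.+1 ^+ 2.
Proof. by rewrite (gap_coord _ hQ hxs hQU) /prev_coord state_shift. Qed.

Hypothesis stab : forall i, stable (bi i) (ci i).
Hypothesis lam_gt0 : forall i, 0 < lam 0 i.

(** The weighted sum over the modes of [energy_gain]; the function H is the
    weighted initial storage, which vanishes at the minimizer. *)
Lemma l2_gain_bound G :
  (forall i, mode_gain alpha beta nu lam i <= G ^+ 2) ->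
  is_l2_gain_bound f xs alpha beta nu G.
Proof.
move=> hG.
pose S (x : 'cV[R]_d) i := let e := (U^T *m (x - xs)) i 0 in
  lam 0 i / 2 / rate (bi i) (ci i) ^+ 2 * storage (bi i) (ci i) e e.
have S0 x i : 0 <= S x i.
  rewrite /S mulr_ge0 ?storage_ge0 // divr_ge0 ?sqr_ge0 // divr_ge0 // ltW //.
exists (fun x => \sum_i S x i); split=> [x||x0 w hw].
- by apply: sumr_ge0 => i _.
- apply: big1 => i _; rewrite /S subrr mulmx0 mxE /storage.
  by case: ifP => _; ring.
have -> : total_gap f xs (gmm f alpha beta nu w x0)
  = nnsum (fun k => f (gmm f alpha beta nu w x0 k) - f xs) by [].
have wE : sqsum w = nnsum (fun k => enorm (w k) ^+ 2) by [].
have w0 k : 0 <= enorm (w k) ^+ 2 by rewrite sqr_ge0.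
have finw : sqsum w = (fine (sqsum w))%:E.
  rewrite fineK // fin_numE -ltey hw andbT wE -ltNye.
  by apply: lt_le_trans (nnsum_partial 0 w0); rewrite big_ord0 ltNyr.
rewrite finw -EFinM -EFinD; apply: nnsum_le => [k|N].
  by rewrite subr_ge0 hxs.
have hN : \sum_(k < N) enorm (w k) ^+ 2 <= fine (sqsum w).
  by rewrite -lee_fin -finw; exact: nnsum_partial.
under eq_bigr do rewrite gap_prev_coord.
rewrite exchange_big /=.
apply: (@le_trans _ _ (\sum_i (G ^+ 2 * (\sum_(k < N) (U^T *m w k) i 0 ^+ 2) + S x0 i))).
  apply: ler_sum => i _; rewrite -mulr_sumr.
  have := energy_gain (prev_coord w x0 i) N (stab i).
  under [X in _ <= X + _ -> _]eq_bigr do rewrite prev_coord_rec exprMn sqrrN.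
  rewrite -mulr_sumr; set P := \sum_(_ < _) _; set W := \sum_(_ < _) _ => hg.
  have r0 : 0 < rate (bi i) (ci i) ^+ 2 by rewrite exprn_gt0 ?rate_gt0.
  have W0 : 0 <= W by apply: sumr_ge0 => k _; rewrite sqr_ge0.
  apply: (@le_trans _ _ (mode_gain alpha beta nu lam i * W + S x0 i)); last first.
    by rewrite lerD2r ler_wpM2r.
  have -> : mode_gain alpha beta nu lam i * W + S x0 i
    = lam 0 i / 2 * ((alpha ^+ 2 * W
        + storage (bi i) (ci i) (prev_coord w x0 i 1) (prev_coord w x0 i 0))
          / rate (bi i) (ci i) ^+ 2).
    by rewrite /mode_gain /S /prev_coord /=; ring.
  apply: ler_wpM2l; first by rewrite divr_ge0 // ltW.
  by rewrite ler_pdivlMr // mulrC.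
rewrite big_split /= lerD2r -mulr_sumr; apply: ler_wpM2l; first exact: sqr_ge0.
rewrite exchange_big /=; apply: le_trans hN; rewrite le_eqVlt; apply/orP; left; apply/eqP.
by apply: eq_bigr => k _; rewrite coord_norm // enorm_sqr.
Qed.

Lemma output_gap w x0 k :
  enorm (output f alpha beta nu U lam xs w x0 k) ^+ 2
    = f (gmm f alpha beta nu w x0 k) - f xs.
Proof.
rewrite (gap_coord _ hQ hxs hQU) /output /gmm.
case: (gmm_state _ _ _ _ _ _ _) => x xp /=.
rewrite /Tmx mul_row_col mul0mx addr0 enorm_sqr; apply: eq_bigr => i _.
rewrite -scalemxAl -mulmxA mxE mul_diag_mx !exprMn exprVn.
rewrite mxE [map_mx _ _ _ _]mxE exprMn !sqr_sqrtr ?ltW //; ring.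
Qed.

(** An eigendirection is invariant, so a noise along it excites one scalar mode. *)
Lemma gmm_eigenvector (u : 'cV[R]_d) l (n : nat -> R) k : Q *m u = l *: u ->
  gmm_state f alpha beta nu (fun j => n j *: u) xs k =
  let e := response (b_ alpha beta nu l) (c_ alpha beta nu l) (fun j => - alpha * n j) k
  in (xs + e.1 *: u, xs + e.2 *: u).
Proof.
move=> hu; elim: k => [|k /= ->]; first by rewrite /= scale0r addr0.
case: (response _ _ _ k) => e ep /=; congr pair.
rewrite grad_gap.
have -> : xs + e *: u - (xs + ep *: u) = (e - ep) *: u.
  by rewrite opprD addrACA subrr add0r scalerBl.
have -> : xs + e *: u + nu *: ((e - ep) *: u) - xs = (e + nu * (e - ep)) *: u.
  by rewrite scalerA addrC -addrA addKr -scalerDl.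
rewrite -scalemxAr hu !scalerA -scalerDl scalerA -addrA -addrA -scaleNr -!scalerDl.
by congr (_ + _ *: _); rewrite /b_ /c_; ring.
Qed.

Lemma gap_eigenvector (u : 'cV[R]_d) l e : Q *m u = l *: u -> enorm u = 1 ->
  f (xs + e *: u) - f xs = l / 2 * e ^+ 2.
Proof.
move=> hu u1; rewrite (quadratic_gap _ _ hQ.1 (minimizer_critical hQ hxs)).
rewrite addrC addKr -scalemxAr hu !dotZl !dotZr.
have -> : dot u u = 1.
  by rewrite -(expr1n R 2) -u1 enorm_sqr dotE; apply: eq_bigr => i _; rewrite expr2.
by field.
Qed.
End GMM.

(** * The worst-case gain *)

(** [rate_between] for s = alpha l, where M is scaled so that the condition
    M s <= rate^2 reads l / rate^2 <= m^2. *)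
Lemma mode_gain_le (R : realType) (alpha beta nu mu L l m : R) :
  0 < alpha -> 0 <= nu -> 0 < mu -> mu <= l <= L ->
  let b := b_ alpha beta nu in let c := c_ alpha beta nu in
  stable (b mu) (c mu) -> stable (b L) (c L) ->
  Num.sqrt mu / rate (b mu) (c mu) <= m -> Num.sqrt L / rate (b L) (c L) <= m ->
  l / rate (b l) (c l) ^+ 2 <= m ^+ 2.
Proof.
move=> a0 nu0 mu0 /andP[h1 h2] b c st1 st2 hm1 hm2.
have r1 := rate_gt0 st1; have r2 := rate_gt0 st2.
have L0 : 0 < L by lra.
have m0 : 0 < m by apply: lt_le_trans hm1; rewrite divr_gt0 ?sqrtr_gt0.
have am : 0 < alpha * m ^+ 2 by rewrite mulr_gt0 ?exprn_gt0.
have e x y : 0 < x -> 0 < y -> Num.sqrt x / y <= m ->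
    (alpha * m ^+ 2)^-1 * (alpha * x) <= y ^+ 2.
  move=> x0 y0; rewrite ler_pdivrMr // => h.
  have : Num.sqrt x ^+ 2 <= (m * y) ^+ 2.
    by rewrite ler_pXn2r ?nnegrE ?sqrtr_ge0 // mulr_ge0 ?ltW.
  rewrite sqr_sqrtr ?(ltW x0) // exprMn => hx.
  by rewrite ler_pdivrMl // -mulrA ler_pM2l.
have als : alpha * mu <= alpha * l <= alpha * L by rewrite !ler_pM2l // h1 h2.
have := @rate_between _ (alpha * m ^+ 2)^-1 beta nu (alpha * mu) (alpha * l) (alpha * L)
  nu0 (ltW _) _ als st1 st2 (e _ _ mu0 r1 hm1) (e _ _ L0 r2 hm2).
rewrite invr_gt0 => /(_ am (mulr_gt0 a0 mu0)).
rewrite ler_pdivrMl // -mulrA ler_pM2l // => h.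
have st := @stable_between _ beta nu _ _ _ als st1 st2.
by rewrite ler_pdivrMr // exprn_gt0 // rate_gt0.
Qed.

Section Main.
Variables (R : realType) (d : nat) (Q : 'M[R]_d) (p : 'cV[R]_d) (r : R).
Variables (xs : 'cV[R]_d) (alpha beta nu l : R) (u : 'cV[R]_d).
Hypothesis hQ : posdef Q.
Hypothesis hxs : forall x, quadratic Q p r xs <= quadratic Q p r x.
Hypothesis hu : Q *m u = l *: u.
Hypothesis u1 : enorm u = 1.
Hypotheses (l0 : 0 < l) (alpha0 : 0 <= alpha).
Let f := quadratic Q p r.
Let om := omega alpha beta nu l.
Let b := b_ alpha beta nu l.
Let c := c_ alpha beta nu l.
Hypothesis st : stable b c.
Let w := worst_noise om u.
Let C (k : nat) := cos (om * k%:R).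
Let hC : cosine_like (cos om) C := cosine_like_cos om.
Let ht : cos om = peak_cos b c := cos_omega st.

Let W h := noise_energy (cos om) C h.
Let Z h := response_energy b c (- alpha) (cos om) C h.

Lemma sqsum_worst_noise h : 0 < h < 1 -> sqsum (w h) = (W h)%:E.
Proof.
move=> hh; have [<- _] := noise_sum st hC ht hh.
apply: eq_eseriesr => k _; congr (_%:E).
rewrite enorm_sqr /w /worst_noise -/(C k) -/(noise (cos om) h C k).
under eq_bigr do rewrite mxE exprMn.
by rewrite -mulr_sumr -enorm_sqr u1 expr1n mulr1.
Qed.

Lemma total_gap_worst_noise h : 0 < h < 1 ->
  total_gap f xs (gmm f alpha beta nu (w h) xs) = (l / 2 * Z h)%:E.
Proof.
move=> hh; have [e _ _] := response_sum (- alpha) st hC ht hh.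
rewrite EFinM /Z -e /nnsum -nneseriesZl; last by move=> i _; rewrite lee_fin sqr_ge0.
apply: eq_eseriesr => k _; rewrite -EFinM; congr (_%:E).
rewrite /gmm (gmm_eigenvector alpha beta nu hQ hxs _ k hu) /=.
by rewrite /f (gap_eigenvector hQ hxs _ hu u1).
Qed.

Lemma worst_noise_ratio_cvg :
  Num.sqrt (l / 2 * Z h) / Num.sqrt (W h) @[h --> 0^'+]
    --> alpha / Num.sqrt 2 * (Num.sqrt l / rate b c).
Proof.
have r0 := rate_gt0 st.
have lim : Num.sqrt (l / 2 * (Z h / W h)) @[h --> 0^'+]
    --> Num.sqrt (l / 2 * ((- alpha) ^+ 2 / rate b c ^+ 2)).
  apply: (@cvg_comp _ _ _ (fun h => l / 2 * (Z h / W h)) Num.sqrt); last exact: sqrt_continuous.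
  by apply: cvgM; [exact: cvg_cst|exact: energy_ratio_cvg st hC ht].
have -> : alpha / Num.sqrt 2 * (Num.sqrt l / rate b c)
    = Num.sqrt (l / 2 * ((- alpha) ^+ 2 / rate b c ^+ 2)).
  have -> : l / 2 * ((- alpha) ^+ 2 / rate b c ^+ 2) = (alpha / rate b c) ^+ 2 * (l / 2).
    by field; rewrite gt_eqF.
  rewrite sqrtrM ?sqr_ge0 // sqrtr_sqr sqrtrM ?(ltW l0) // sqrtrV //.
  rewrite ger0_norm ?divr_ge0 ?(ltW r0) //; ring.
apply: cvg_trans lim; apply: near_eq_cvg; near=> h.
have h0 : 0 < h by near: h; apply: nbhs_right_gt.
have h1 : h < 1 by near: h; apply: nbhs_right_lt; lra.
have hh : 0 < h < 1 by rewrite h0.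
have [_ Wp] := noise_sum st hC ht hh.
have W0 : 0 <= W h by have := Wp 0%N; rewrite big_ord0.
by rewrite mulrA mulrC sqrtrM ?invr_ge0 // sqrtrV // mulrC.
Unshelve. all: by end_near. Qed.

(** Applied to the worst-case noise, started at the minimizer where H vanishes,
    the square of a gain bound is at least the energy ratio for each h, and so
    the gain bound is at least the limit. *)
Lemma gain_bound_ge g : 0 < g -> is_l2_gain_bound f xs alpha beta nu g ->
  alpha / Num.sqrt 2 * (Num.sqrt l / rate b c) <= g.
Proof.
move=> g0 [H [_ Hxs hH]].
apply: (cvgr_to_le worst_noise_ratio_cvg); near=> h.
have h0 : 0 < h by near: h; apply: nbhs_right_gt.
have h1 : h < 1 by near: h; apply: nbhs_right_lt; lra.
have hh : 0 < h < 1 by rewrite h0.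
have := hH xs (w h); rewrite sqsum_worst_noise // ltry => /(_ isT).
rewrite total_gap_worst_noise // Hxs adde0 -EFinM lee_fin => hle.
have [_ Wp] := noise_sum st hC ht hh.
have W0 : 0 <= W h by have := Wp 0%N; rewrite big_ord0.
have [W00|Wn] := eqVneq (W h) 0; first by rewrite W00 sqrtr0 invr0 mulr0 ltW.
have W1 : 0 < W h by rewrite lt_neqAle eq_sym Wn.
rewrite ler_pdivrMr ?sqrtr_gt0 // -(ger0_norm (ltW g0)) -sqrtr_sqr -sqrtrM ?sqr_ge0 //.
by rewrite ler_wsqrtr.
Unshelve. all: by end_near. Qed.
End Main.

Theorem proposition4p5 (R : realType) (d : nat)
    (Q : 'M[R]_d) (p : 'cV[R]_d) (r : R) (mu L : R)
    (hQ : posdef Q)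
    (hmu : is_smallest_eigenvalue Q mu) (hL : is_largest_eigenvalue Q L)
    (hmu0 : 0 < mu) (hmuL : mu < L)
    (U : 'M[R]_d) (lam : 'rV[R]_d)
    (hU : ordered_eigendecomposition Q U lam)
    (xs : 'cV[R]_d)
    (hxs : forall x, quadratic Q p r xs <= quadratic Q p r x)
    (alpha beta nu : R)
    (halpha : 0 < alpha) (hbeta : 0 <= beta) (hnu : 0 <= nu)
    (hrho : spectral_radius (AQ alpha beta nu Q) < 1)
    (ls : R) (hls : ls = mu \/ ls = L)
    (hmax : Num.max (Num.sqrt mu / r_ alpha beta nu mu)
                    (Num.sqrt L / r_ alpha beta nu L)
            = Num.sqrt ls / r_ alpha beta nu ls)
    (u1 ud : 'cV[R]_d)
    (hu1 : Q *m u1 = mu *: u1) (hu1n : enorm u1 = 1)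
    (hud : Q *m ud = L *: ud) (hudn : enorm ud = 1) :
  let f := quadratic Q p r in
  let us := if ls == mu then u1 else ud in
  let w := worst_noise (omega alpha beta nu ls) us in
  let x h := gmm f alpha beta nu (w h) xs in
  let z h := output f alpha beta nu U lam xs (w h) xs in
  let L2 := L2star f xs alpha beta nu in
  let Hoo := Hinf alpha beta nu Q U lam in
  (forall h, 0 < h < 1 ->
    [/\ (sqsum (w h) < +oo)%E,
        (sqsum (z h) < +oo)%E
      & Num.sqrt (fine (total_gap f xs (x h))) / l2norm (w h)
        = l2norm (z h) / l2norm (w h)]) /\
  [/\ l2norm (z h) / l2norm (w h) @[h --> 0^'+] --> L2,
      L2 = Hoo,
      (* the supremum [Hinf] over the unit circle is a maximum *)
      exists2 zeta : R[i], `|zeta| = 1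
        & spectral_norm (transfer alpha beta nu Q U lam zeta) = Hoo
    & L2 = alpha / Num.sqrt 2 *
           Num.max (Num.sqrt mu / r_ alpha beta nu mu)
                   (Num.sqrt L / r_ alpha beta nu L)].
Proof.
move=> f us w x z L2 Hoo; have [hUU hQU _] := hU; have [hQT _] := hQ.
have eig i : eigenvalue Q (lam 0 i) := eigenvalue_coord i hUU hQU.
have lam0 i : 0 < lam 0 i by apply: lt_le_trans hmu0 (hmu.2 _ (eig i)).
have stab l : eigenvalue Q l -> stable (b_ alpha beta nu l) (c_ alpha beta nu l).
  by move=> hl; apply: stable_mode hQT hrho hl.
have els : eigenvalue Q ls by case: hls => ->; [exact: hmu.1|exact: hL.1].
have ls0 : 0 < ls by apply: lt_le_trans hmu0 (hmu.2 _ els).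
have usE : Q *m us = ls *: us /\ enorm us = 1.
  rewrite /us; case: eqP => [->//|ne].
  by case: hls => // ->.
case: usE => hus us1.
have st := stab ls els.
pose m := Num.sqrt ls / r_ alpha beta nu ls.
pose G := alpha / Num.sqrt 2 * m.
have mE : m = Num.sqrt ls / rate (b_ alpha beta nu ls) (c_ alpha beta nu ls).
  by rewrite /m r_rate.
have m0 : 0 < m by rewrite mE divr_gt0 ?sqrtr_gt0 ?rate_gt0.
have G0 : 0 < G by rewrite /G mulr_gt0 // divr_gt0 // sqrtr_gt0.
have G2 : G ^+ 2 = alpha ^+ 2 / 2 * m ^+ 2.
  by rewrite /G !exprMn exprVn sqr_sqrtr.
have [m1 m2] : Num.sqrt mu / r_ alpha beta nu mu <= m /\
    Num.sqrt L / r_ alpha beta nu L <= m.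
  by rewrite /m -hmax !le_max !lexx orbT.
rewrite !r_rate in m1 m2.
have gE i : mode_gain alpha beta nu lam i
    = alpha ^+ 2 / 2 * (lam 0 i / rate (b_ alpha beta nu (lam 0 i))
        (c_ alpha beta nu (lam 0 i)) ^+ 2).
  by rewrite /mode_gain; ring.
have gle i : mode_gain alpha beta nu lam i <= G ^+ 2.
  rewrite gE G2; apply: ler_wpM2l; first by rewrite divr_ge0 ?sqr_ge0.
  apply: (mode_gain_le halpha hnu hmu0 _ (stab _ hmu.1) (stab _ hL.1) m1 m2).
  by rewrite hmu.2 //= hL.2.
have [i0 hi0] := eigen_index hUU hQU els.
have gi0 : mode_gain alpha beta nu lam i0 = G ^+ 2.
  by rewrite gE G2 hi0 mE exprMn exprVn sqr_sqrtr ?(ltW ls0).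
have [HE Hz] := Hinf_max hUU hQU hrho lam0 (ltW G0) gle gi0.
have ratio := worst_noise_ratio_cvg ls0 (ltW halpha) st.
rewrite -mE -/G in ratio.
have L2E : L2 = G.
  have GS : 0 < G /\ is_l2_gain_bound f xs alpha beta nu G.
    split=> //; apply: (l2_gain_bound hQ hxs hUU hQU _ lam0 gle) => i.
    exact: stab.
  have lb g : 0 < g /\ is_l2_gain_bound f xs alpha beta nu g -> G <= g.
    case=> g0 hg; have := gain_bound_ge hQ hxs hus us1 ls0 (ltW halpha) st g0 hg.
    by rewrite -mE.
  apply/eqP; rewrite eq_le; apply/andP; split.
    by apply: ge_inf => //; exists G.
  by apply: lb_le_inf => //; exists G.
have wE h : 0 < h < 1 -> sqsum (w h)
    = (noise_energy (cos (omega alpha beta nu ls))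
        (fun k => cos (omega alpha beta nu ls * k%:R)) h)%:E.
  exact: sqsum_worst_noise us1 st h.
have zx h : sqsum (z h) = total_gap f xs (x h).
  by apply: eq_eseriesr => k _; congr (_%:E); apply: (output_gap _ _ _ hQ hxs hQU).
have xE h (hh : 0 < h < 1) := total_gap_worst_noise hQ hxs hus us1 st hh.
split=> [h hh|].
  split; first by rewrite wE // ltry.
    by rewrite zx /x xE // ltry.
  by rewrite /l2norm zx.
split.
- rewrite L2E; apply: cvg_trans ratio; apply: near_eq_cvg; near=> h.
  have h0 : 0 < h by near: h; apply: nbhs_right_gt.
  have h1 : h < 1 by near: h; apply: nbhs_right_lt; lra.
  have hh : 0 < h < 1 by rewrite h0.
  by rewrite /l2norm zx /x xE // wE.
- by rewrite L2E /Hoo HE.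
- by case: Hz => zeta h1 h2; exists zeta => //; rewrite /Hoo HE.
- by rewrite L2E hmax.
Unshelve. all: by end_near. Qed.
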